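(* Let $(A,\alpha)$ be a $C^*$-dynamical system, let $J$ be an ideal in $A$ with $J\cap\ker\alpha=\{0\}$, and let $(\pi_i,U_i,H_i)$, $i=1,2$, be faithful $J$-covariant representations of $(A,\alpha)$ possessing property $( * )$. Then the relations $$\Phi(\pi_1(a)):=\pi_2(a),\quad a\in A,\qquad \Phi(U_1):=U_2$$ give rise to a $*$-isomorphism $\Phi$ between the $C^*$-algebras $C^*(\pi_1(A),U_1)$ and $C^*(\pi_2(A),U_2)$.
   Context: A $C^*$-dynamical system is a pair $(A,\alpha)$ where $A$ is a unital $C^*$-algebra and $\alpha:A\to A$ is a $*$-endomorphism (not assumed unital or injective). ''Ideal'' means closed two-sided ideal; $\mathbb N=\{0,1,2,\dots\}$. A representation of $(A,\alpha)$ is a triple $(\pi,U,H)$ consisting of a unital $*$-representation $\pi:A\to L(H)$ on a Hilbert space $H$ and an operator $U\in L(H)$ with $U\pi(a)U^*=\pi(\alpha(a))$ for all $a\in A$. It is faithful if $\pi$ is injective, and $J$-covariant (for an ideal $J$ in $A$) if $J=\{a\in A: U^*U\pi(a)=\pi(a)\}$. $C^*(\pi(A),U)$ is the $C^*$-subalgebra of $L(H)$ generated by $\pi(A)$ and $U$. A faithful representation $(\pi,U,H)$ possesses property $( * )$ if for every finitely supported family $\{a_{m,n}\}_{m,n\in\mathbb N}$ with $a_{m,n}\in\alpha^m(1)A\alpha^n(1)$ one has $$\Big\|\sum_{m\in\mathbb N}U^{*m}\pi(a_{m,m})U^m\Big\|\le\Big\|\sum_{m,n\in\mathbb N}U^{*m}\pi(a_{m,n})U^n\Big\|.$$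 *)

(* Defs.v *)
From HB Require Import structures.
From mathcomp Require Import all_boot order ssralg ssrnum complex.
From mathcomp Require Import boolp classical_sets functions cardinality fsbigop.
From mathcomp Require Import reals topology normedtype.
From mathcomp Require Import ring lra.

Set Implicit Arguments.
Unset Strict Implicit.
Unset Printing Implicit Defensive.

Import Order.TTheory GRing.Theory Num.Theory.
Import numFieldNormedType.Exports.

Local Open Scope classical_set_scope.
Local Open Scope complex_scope.
Local Open Scope ring_scope.

(* not the algC-style real part [Num.Re], which is R[i]-valued *)
Local Notation Re := complex.Re.

(* The scalar field is R[i] = C for R : realType.  In a normed module over R[i]
   the norm takes its values in R[i] (it is a nonnegative real complex number). *)

(* The inner product is linear in its first argument. *)
HB.mixin Record isHilbert (R : realType) H & CompleteNormedModule R[i] H := {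
  inner : H -> H -> R[i];
  inner_linear : forall (a : R[i]) (x y z : H),
    inner (a *: x + y) z = a * inner x z + inner y z;
  inner_conj : forall x y : H, inner y x = Num.conj (inner x y);
  inner_norm : forall x : H, inner x x = `|x| ^+ 2
}.

#[short(type="hilbertType")]
HB.structure Definition Hilbert (R : realType) :=
  {H of CompleteNormedModule R[i] H & isHilbert R H}.

(* Unital C*-algebras; the zero algebra (1 = 0) is allowed.  The product is a
   field of the mixin, since MathComp has no join of rings and normed modules;
   the ring structure is recovered right below. *)
HB.mixin Record isCStarAlgebra (R : realType) A & CompleteNormedModule R[i] A := {
  cmul : A -> A -> A;
  cone : A;
  cmulA : associative cmul;
  cmul1l : left_id cone cmul;
  cmul1r : right_id cone cmul;
  cmulDl : left_distributive cmul +%R;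
  cmulDr : right_distributive cmul +%R;
  cscalerAl : forall (k : R[i]) (x y : A), k *: cmul x y = cmul (k *: x) y;
  cscalerAr : forall (k : R[i]) (x y : A), k *: cmul x y = cmul x (k *: y);
  cnormM : forall x y : A, `|cmul x y| <= `|x| * `|y|;
  star : A -> A;
  starK : involutive star;
  starD : forall x y : A, star (x + y) = star x + star y;
  starZ : forall (k : R[i]) (x : A), star (k *: x) = Num.conj k *: star x;
  starM : forall x y : A, star (cmul x y) = cmul (star y) (star x);
  cstar_norm : forall x : A, `|cmul (star x) x| = `|x| ^+ 2
}.

#[short(type="cstarAlgType")]
HB.structure Definition CStarAlgebra (R : realType) :=
  {A of CompleteNormedModule R[i] A & isCStarAlgebra R A}.

HB.instance Definition _ (R : realType) (A : cstarAlgType R) :=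
  GRing.Zmodule_isPzRing.Build (CStarAlgebra.sort A)
    cmulA cmul1l cmul1r cmulDl cmulDr.

Section ComplexReal.
Variable R : realType.
Implicit Types s t : R.

Lemma CD s t : (s + t)%:C = s%:C + t%:C. Proof. exact: rmorphD. Qed.
Lemma CM s t : (s * t)%:C = s%:C * t%:C. Proof. exact: rmorphM. Qed.
Lemma CX2 s : (s ^+ 2)%:C = s%:C ^+ 2. Proof. exact: rmorphXn. Qed.
Lemma CV s : (s^-1)%:C = s%:C^-1. Proof. exact: fmorphV. Qed.

Lemma normC_real t : `|t%:C| = `|t|%:C.
Proof. by rewrite normc_def/= expr0n addr0 sqrtr_sqr. Qed.

End ComplexReal.

Section RealNorm.
Variables (R : realType) (V : normedModType R[i]).
Implicit Types x y : V.

Definition nrm x : R := Re `|x|.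

Lemma nrmE x : (nrm x)%:C = `|x|.
Proof. by rewrite /nrm RRe_real// normr_real. Qed.

Lemma nrm_ge0 x : 0 <= nrm x.
Proof. by rewrite -ler0c nrmE. Qed.

Lemma nrmD x y : nrm (x + y) <= nrm x + nrm y.
Proof. by rewrite -lecR CD !nrmE ler_normD. Qed.

Lemma nrmN x : nrm (- x) = nrm x.
Proof. by rewrite /nrm normrN. Qed.

Lemma nrmZ (k : R[i]) x : nrm (k *: x) = Re `|k| * nrm x.
Proof.
by apply: complexI; rewrite CM !nrmE normrZ RRe_real// normr_real.
Qed.

Lemma nrm0 : nrm (0 : V) = 0.
Proof. by rewrite /nrm normr0. Qed.

Lemma nrm0_eq0 x : nrm x = 0 -> x = 0.
Proof. by move=> x0; apply/eqP; rewrite -normr_eq0 -nrmE x0. Qed.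

End RealNorm.

Section HilbertTheory.
Variables (R : realType) (H : hilbertType R).
Implicit Types (x y z : H) (a : R[i]).

Lemma innerDl x y z : inner (x + y) z = inner x z + inner y z.
Proof. by have := inner_linear 1 x y z; rewrite scale1r mul1r. Qed.

Lemma inner0l z : inner 0 z = 0.
Proof. by apply: (addIr (inner 0 z)); rewrite -innerDl !add0r. Qed.

Lemma innerZl a x z : inner (a *: x) z = a * inner x z.
Proof. by have := inner_linear a x 0 z; rewrite !addr0 inner0l addr0. Qed.

Lemma innerNl x z : inner (- x) z = - inner x z.
Proof. by rewrite -scaleN1r innerZl mulN1r. Qed.

Lemma innerDr x y z : inner x (y + z) = inner x y + inner x z.
Proof. by rewrite inner_conj innerDl rmorphD/= -!inner_conj. Qed.

Lemma innerZr a x z : inner x (a *: z) = Num.conj a * inner x z.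
Proof. by rewrite inner_conj innerZl rmorphM/= -!inner_conj. Qed.

Lemma innerNr x z : inner x (- z) = - inner x z.
Proof. by rewrite inner_conj innerNl rmorphN/= -inner_conj. Qed.

Definition rin x y : R := Re (inner x y).

Lemma rinDl x y z : rin (x + y) z = rin x z + rin y z.
Proof. by rewrite /rin innerDl; case: (inner x z) (inner y z) => [? ?] []. Qed.

Lemma rinDr x y z : rin x (y + z) = rin x y + rin x z.
Proof. by rewrite /rin innerDr; case: (inner x y) (inner x z) => [? ?] []. Qed.

Lemma rinC x y : rin x y = rin y x.
Proof. by rewrite /rin inner_conj; case: (inner y x). Qed.

Lemma rinZl (t : R) x y : rin (t%:C *: x) y = t * rin x y.
Proof. by rewrite /rin innerZl; case: (inner x y) => u v /=; rewrite mul0r subr0. Qed.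

Lemma rinZr (t : R) x y : rin x (t%:C *: y) = t * rin x y.
Proof. by rewrite rinC rinZl rinC. Qed.

Lemma rinNl x y : rin (- x) y = - rin x y.
Proof. by rewrite /rin innerNl; case: (inner x y). Qed.

Lemma rinNr x y : rin x (- y) = - rin x y.
Proof. by rewrite rinC rinNl rinC. Qed.

Lemma rinxx x : rin x x = nrm x ^+ 2.
Proof. by apply: complexI; rewrite CX2 nrmE /rin RRe_real inner_norm// rpredX// normr_real. Qed.

Lemma rin_le x y : rin x y <= nrm x * nrm y.
Proof.
have [y0|y0] := eqVneq (nrm y) 0.
  rewrite (nrm0_eq0 y0) nrm0 mulr0.
  by rewrite /rin inner_conj inner0l conjC0.
have yp : 0 < nrm y by rewrite lt_def y0 nrm_ge0.
pose t := rin x y / nrm y ^+ 2.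
have : 0 <= nrm (x - t%:C *: y) ^+ 2 by rewrite exprn_ge0// nrm_ge0.
rewrite -rinxx !(rinDl, rinDr, rinNl, rinNr, rinZl, rinZr) (rinC y x) !rinxx.
have -> : nrm x ^+ 2 - t * rin x y + (- (t * rin x y) - - (t * (t * nrm y ^+ 2)))
    = nrm x ^+ 2 - rin x y ^+ 2 / nrm y ^+ 2.
  by rewrite /t; field.
rewrite subr_ge0 ler_pdivrMr ?exprn_gt0// -exprMn => h.
have [|r0] := leP (rin x y) 0.
  by move=> /le_trans; apply; rewrite mulr_ge0 ?nrm_ge0.
by rewrite -(@ler_pXn2r _ 2)// ?nnegrE ?mulr_ge0 ?nrm_ge0// ltW.
Qed.

Lemma cauchy_schwarz x y : `|inner x y| <= `|x| * `|y|.
Proof.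
have [->|z0] := eqVneq (inner x y) 0; first by rewrite normr0 mulr_ge0.
set z := inner x y in z0 *.
have nz : `|z| != 0 by rewrite normr_eq0.
pose c := Num.conj z / `|z|.
have c1 : `|c| = 1 by rewrite /c normrM norm_conjC normfV normr_id divff.
have cz : inner (c *: x) y = `|z|.
  by rewrite innerZl -/z /c mulrAC [_ * z]mulrC -normCK expr2 mulfK.
have := rin_le (c *: x) y.
by rewrite /rin cz nrmZ c1 mul1r -lecR CM !nrmE RRe_real// normr_real.
Qed.

Lemma riesz (f : H -> R[i]) (M : R) :
  (forall a x y, f (a *: x + y) = a * f x + f y) ->
  (forall x, `|f x| <= M%:C * `|x|) -> 0 <= M ->
  exists y, forall x, f x = inner x y.
Proof.
move=> flin fM M0.
have fD x y : f (x + y) = f x + f y by have := flin 1 x y; rewrite scale1r mul1r.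
have f0 : f 0 = 0 by apply: (addIr (f 0)); rewrite -fD !add0r.
have fZ a x : f (a *: x) = a * f x by have := flin a x 0; rewrite !addr0 f0 addr0.
pose g x := Re (f x).
have gD x y : g (x + y) = g x + g y.
  by rewrite /g fD; case: (f x) (f y) => [? ?] [].
have gZ (t : R) x : g (t%:C *: x) = t * g x.
  by rewrite /g fZ; case: (f x) => u v /=; rewrite mul0r subr0.
have gM x : g x <= M * nrm x.
  have := le_trans (normc_ge_Re (f x)) (fM x).
  by rewrite -nrmE -CM lecR => /(le_trans (ler_norm _)).
pose J x := nrm x ^+ 2 - 2 * g x.
have Jlb x : - M ^+ 2 <= J x.
  have := gM x; have := sqr_ge0 (nrm x - M); rewrite /J => *; nra.
have Jinf : has_inf (range J).
  by split; [exists (J 0), 0 | exists (- M ^+ 2) => _ [x _ <-]].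
pose m := inf (range J).
have mJ x : m <= J x by apply: ge_inf; [exact: Jinf.2 | exists x].
pose F := filter_from [set e : R | 0 < e] (fun e => [set x | J x < m + e]).
have FF : ProperFilter F.
  apply: filter_from_proper; last first.
    move=> e e0; have [_ [x _ <-] xe] := inf_adherent e0 Jinf.
    by exists x.
  apply: filter_from_filter; first by exists 1 => /=.
  move=> e1 e2 /= p1 p2; exists (Order.min e1 e2); first by rewrite /= lt_min p1 p2.
  by move=> x /=; rewrite -ltrBlDl lt_min !ltrBlDl => /andP.
have Jd x y (e : R) : J x < m + e -> J y < m + e -> nrm (x - y) ^+ 2 < 4 * e.
  move=> Jx Jy; have := mJ (2^-1%:C *: (x + y)).
  rewrite /J -!rinxx in Jx Jy *.
  rewrite !(gZ, gD, rinDl, rinDr, rinNl, rinNr, rinZl, rinZr) !(rinC y x) => ?.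
  lra.
have Fc : cauchy F.
  apply/cauchy_exP => e e0; have er : e = (Re e)%:C.
    by rewrite RRe_real// gtr0_real.
  have re0 : 0 < Re e by rewrite -ltcR -er.
  have d0 : 0 < Re e ^+ 2 / 4 by rewrite divr_gt0// exprn_gt0.
  have [_ [x _ <-] xe] := inf_adherent d0 Jinf.
  exists x; exists (Re e ^+ 2 / 4) => //= y ye.
  rewrite -ball_normE /= er -nrmE ltcR.
  have := Jd _ _ _ xe ye; rewrite mulrC divfK ?pnatr_eq0// => h.
  by rewrite -(@ltr_pXn2r _ 2)// ?nnegrE ?nrm_ge0// ltW.
have /cvg_ex [l Fl] : cvg F by exact: cauchy_cvg.
exists l.
have Hre x : g x = rin x l.
  pose n := nrm x; pose d := rin l x - g x.
  have key (t : R) : 0 <= 2 * t * d + t ^+ 2 * n ^+ 2.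
    apply/ler_addgt0Pr => e e0.
    pose L := 1 + 2 * `|t| * n.
    have L0 : 0 < L by rewrite ltr_pwDl// !mulr_ge0// nrm_ge0.
    pose e' := e / L.
    have e'0 : 0 < e' by rewrite divr_gt0.
    have : F (ball l e'%:C).
      by apply: Fl; apply: nbhsx_ballx; rewrite ltcR.
    move=> FB; have Fe : F [set y | J y < m + e'] by exists e'.
    have [y [/= yl Jy]] := @filter_ex _ _ FF _ (filterI FB Fe).
    move: yl; rewrite -ball_normE /= -nrmE ltcR => yl.
    have h1 := mJ (y + t%:C *: x).
    have h2 : `|rin (l - y) x| <= e' * n.
      have le1 (z : H) : nrm z < e' -> rin z x <= e' * n.
        move=> ze; apply: (le_trans (rin_le z x)).
        by rewrite ler_wpM2r ?nrm_ge0// ltW.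
      by rewrite ler_norml lerNl -rinNl !le1// nrmN.
    have h3 : - (`|t| * (e' * n)) <= t * rin (l - y) x.
      by rewrite lerNl; apply: (le_trans (ler_norm _)); rewrite normrN normrM ler_wpM2l.
    have -> : e = e' + 2 * (`|t| * (e' * n)).
      have eL : e' * L = e by rewrite /e' divfK// gt_eqF.
      by rewrite -eL /L; ring.
    move: h1 h3 Jy; rewrite /J -!rinxx !(gD, gZ, rinDl, rinDr, rinNl, rinZl, rinZr).
    rewrite !(rinC x) !rinxx -/n /d => h1 h3 Jy; nra.
  have n1 : 0 < n ^+ 2 + 1 by rewrite ltr_wpDl// sqr_ge0.
  have := key (- d / (n ^+ 2 + 1)).
  have -> : 2 * (- d / (n ^+ 2 + 1)) * d + (- d / (n ^+ 2 + 1)) ^+ 2 * n ^+ 2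
     = - (d ^+ 2 * ((n ^+ 2 + 2) / (n ^+ 2 + 1) ^+ 2)).
    by field; rewrite gt_eqF.
  rewrite oppr_ge0 pmulr_lle0; last by rewrite divr_gt0 ?exprn_gt0// ltr_wpDl// sqr_ge0.
  move=> d2; have : d ^+ 2 = 0 by apply/eqP; rewrite eq_le d2 sqr_ge0.
  move/eqP; rewrite sqrf_eq0 subr_eq0 rinC => /eqP ->.
  by [].
move=> x; have Rex := Hre x; have := Hre ('i *: x).
move: Rex; rewrite /g /rin fZ innerZl.
case: (f x) (inner x l) => [u v] [u' v'] /= -> .
by rewrite !mul0r !mul1r !add0r => /oppr_inj ->.
Qed.

End HilbertTheory.

Section LinearBound.
Variables (R : realType) (V W : normedModType R[i]).

Lemma linear_bound (f : {linear V -> W}) : continuous f ->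
  exists2 M : R, 0 <= M & forall x, nrm (f x) <= M * nrm x.
Proof.
move=> /linear_bounded_continuous/linear_boundedP/pinfty_ex_gt0[r r0 Br].
have rE : r = (Re r)%:C by rewrite RRe_real// gtr0_real.
exists (Re r); first by rewrite ltW// -ltcR -rE.
by move=> x; rewrite -lecR CM !nrmE -rE.
Qed.

Lemma bound_continuous (f : {linear V -> W}) (M : R) :
  (forall x, nrm (f x) <= M * nrm x) -> continuous f.
Proof.
move=> fM; apply/linear_bounded_continuous/linear_boundedP.
exists `|M|%:C; split; first by rewrite -normC_real normr_real.
move=> r Mr x; rewrite -!nrmE (@le_trans _ _ (`|M|%:C * (nrm x)%:C))//.
  by rewrite -CM lecR (le_trans (fM x))// ler_wpM2r ?nrm_ge0// ler_norm.
by rewrite ler_wpM2r ?ler0c ?nrm_ge0// ltW.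
Qed.

End LinearBound.

Record bounded_op (R : realType) (H : hilbertType R) := BoundedOp {
  bop_fun :> H -> H;
  bop_linear : linear bop_fun;
  bop_continuous : continuous bop_fun
}.

Notation "''L' ( H )" := (bounded_op H) (at level 8, format "''L' ( H )").

HB.instance Definition _ (R : realType) (H : hilbertType R) :=
  gen_eqMixin 'L(H).
HB.instance Definition _ (R : realType) (H : hilbertType R) :=
  gen_choiceMixin 'L(H).
HB.instance Definition _ (R : realType) (H : hilbertType R) (T : 'L(H)) :=
  GRing.isLinear.Build R[i] H H *:%R (bop_fun T) (bop_linear T).

Section BoundedOp.
Variables (R : realType) (H : hilbertType R).
Implicit Types (S T : 'L(H)) (x y : H) (k : R[i]).

Lemma bopP S T : S =1 T -> S = T.
Proof.
case: S T => [s sl sc] [t tl tc] /= /funext st; case: t / st tl tc => tl tc.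
by congr BoundedOp; exact: Prop_irrelevance.
Qed.

Fact bop_zero_linear : linear (fun _ : H => 0 : H).
Proof. by move=> k x y /=; rewrite scaler0 addr0. Qed.
Definition bop_zero := BoundedOp bop_zero_linear (@cst_continuous H H 0).

Fact bop_one_linear : linear (@idfun H). Proof. by []. Qed.
Fact bop_one_continuous : continuous (@idfun H). Proof. by move=> x. Qed.
Definition bop_one := BoundedOp bop_one_linear bop_one_continuous.

Fact bop_add_linear S T : linear (fun x => S x + T x).
Proof. by move=> k x y; rewrite !linearP scalerDr addrACA. Qed.
Fact bop_add_continuous S T : continuous (fun x => S x + T x).
Proof. by move=> x; apply: cvgD; apply: bop_continuous. Qed.
Definition bop_add S T :=
  BoundedOp (@bop_add_linear S T) (@bop_add_continuous S T).

Fact bop_scale_linear k T : linear (fun x => k *: T x).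
Proof. by move=> l x y; rewrite linearP scalerDr !scalerA mulrC. Qed.
Fact bop_scale_continuous k T : continuous (fun x => k *: T x).
Proof. by move=> x; apply: cvgZl_tmp; apply: bop_continuous. Qed.
Definition bop_scale k T :=
  BoundedOp (@bop_scale_linear k T) (@bop_scale_continuous k T).

Definition bop_opp T := bop_scale (-1) T.

Fact bop_comp_linear S T : linear (fun x => S (T x)).
Proof. by move=> k x y; rewrite !linearP. Qed.
Fact bop_comp_continuous S T : continuous (fun x => S (T x)).
Proof. by move=> x; apply: continuous_comp; apply: bop_continuous. Qed.
Definition bop_comp S T :=
  BoundedOp (@bop_comp_linear S T) (@bop_comp_continuous S T).

Fact bop_addA : associative bop_add.
Proof. by move=> S T U; apply: bopP => x; exact: addrA. Qed.
Fact bop_addC : commutative bop_add.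
Proof. by move=> S T; apply: bopP => x; exact: addrC. Qed.
Fact bop_add0 : left_id bop_zero bop_add.
Proof. by move=> S; apply: bopP => x; exact: add0r. Qed.
Fact bop_addN : left_inverse bop_zero bop_opp bop_add.
Proof. by move=> S; apply: bopP => x /=; rewrite scaleN1r addNr. Qed.
HB.instance Definition _ :=
  GRing.isZmodule.Build 'L(H) bop_addA bop_addC bop_add0 bop_addN.

Fact bop_scaleA k l T : bop_scale k (bop_scale l T) = bop_scale (k * l) T.
Proof. by apply: bopP => x; exact: scalerA. Qed.
Fact bop_scale1 : left_id 1 bop_scale.
Proof. by move=> T; apply: bopP => x; exact: scale1r. Qed.
Fact bop_scaleDr : right_distributive bop_scale +%R.
Proof. by move=> k S T; apply: bopP => x; exact: scalerDr. Qed.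
Fact bop_scaleDl T : {morph bop_scale^~ T : k l / k + l}.
Proof. by move=> k l; apply: bopP => x; exact: scalerDl. Qed.
HB.instance Definition _ := GRing.Zmodule_isLmodule.Build R[i] 'L(H)
  bop_scaleA bop_scale1 bop_scaleDr bop_scaleDl.

Definition opnorm T : R := sup [set nrm (T x) | x in [set x | `|x| <= 1]].

Lemma bop_bound T : exists2 M : R, 0 <= M & forall x, nrm (T x) <= M * nrm x.
Proof. exact: (linear_bound (@bop_continuous _ _ T)). Qed.

Fact opnorm_has_sup T : has_sup [set nrm (T x) | x in [set x | `|x| <= 1]].
Proof.
split; first by exists (nrm (T 0)), 0 => //=; rewrite normr0.
have [M M0 TM] := bop_bound T; exists M => _ [x /= x1 <-].
by rewrite (le_trans (TM x))// ler_piMr// -lecR nrmE.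
Qed.

Lemma opnorm_ge0 T : 0 <= opnorm T.
Proof.
rewrite (le_trans (nrm_ge0 (T 0)))//; apply: sup_upper_bound.
  exact: opnorm_has_sup.
by exists 0 => //=; rewrite normr0.
Qed.

Lemma le_opnorm T x : nrm (T x) <= opnorm T * nrm x.
Proof.
have [x0|x0] := eqVneq (nrm x) 0.
  by rewrite (nrm0_eq0 x0) linear0 !nrm0 mulr0.
have xp : 0 < nrm x by rewrite lt_def x0 nrm_ge0.
rewrite -ler_pdivrMr//; apply: sup_upper_bound; first exact: opnorm_has_sup.
exists ((nrm x)^-1%:C *: x) => /=.
  rewrite normrZ -(nrmE x) normC_real -CM lecR ger0_norm ?mulVf//.
  by rewrite invr_ge0 ltW.
by rewrite linearZ nrmZ normC_real/= ger0_norm ?invr_ge0 1?ltW// mulrC.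
Qed.

Lemma opnorm_le T (M : R) : 0 <= M -> (forall x, nrm (T x) <= M * nrm x) ->
  opnorm T <= M.
Proof.
move=> M0 TM; apply: sup_le_ub; first exact: (opnorm_has_sup T).1.
move=> _ [x /= x1 <-]; rewrite (le_trans (TM x))// ler_piMr//.
by rewrite -lecR nrmE.
Qed.

Fact bop_normD S T : (opnorm (S + T))%:C <= (opnorm S)%:C + (opnorm T)%:C.
Proof.
rewrite -CD lecR; apply: opnorm_le; first by rewrite addr_ge0 ?opnorm_ge0.
by move=> x; rewrite (le_trans (nrmD _ _))// mulrDl lerD ?le_opnorm.
Qed.

Fact bop_normZ k T : (opnorm (k *: T))%:C = `|k| * (opnorm T)%:C.
Proof.
have le1 l S : opnorm (l *: S) <= Re `|l| * opnorm S.
  have l0 : 0 <= Re `|l| by rewrite -ler0c RRe_real// normr_real.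
  apply: opnorm_le; first by rewrite mulr_ge0// opnorm_ge0.
  by move=> x; rewrite nrmZ -mulrA ler_wpM2l// le_opnorm.
rewrite -[X in X * _]RRe_real ?normr_real// -CM; congr (_%:C).
apply/eqP; rewrite eq_le le1 andTb.
have [->|k0] := eqVneq k 0; first by rewrite normr0 mul0r opnorm_ge0.
have kp : 0 < Re `|k| by rewrite -ltcR RRe_real ?normr_real// normr_gt0.
rewrite mulrC -ler_pdivlMr// mulrC.
have := le1 k^-1 (k *: T); rewrite scalerA mulVf// scale1r => /le_trans; apply.
rewrite ler_wpM2r ?opnorm_ge0// -lecR RRe_real ?normr_real// normfV.
by rewrite CV RRe_real// normr_real.
Qed.

Fact bop_norm0_eq0 T : (opnorm T)%:C = 0 -> T = 0.
Proof.
move=> /complexI T0; apply: bopP => x; apply: nrm0_eq0.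
apply/eqP; rewrite eq_le nrm_ge0 andbT.
by rewrite (le_trans (le_opnorm T x))// T0 mul0r.
Qed.

HB.instance Definition _ := Lmodule_isNormed.Build R[i] 'L(H)
  bop_normD bop_normZ bop_norm0_eq0.

Lemma bop_normE T : `|T| = (opnorm T)%:C. Proof. by []. Qed.

Lemma nrm_bop T : nrm T = opnorm T. Proof. by []. Qed.

End BoundedOp.

Section BoundedOpComplete.
Variables (R : realType) (H : hilbertType R).

Lemma bop_complete (F : set_system 'L(H)) :
  ProperFilter F -> cauchy F -> cvg F.
Proof.
move=> FF Fc.
have Fe (e : R) : 0 < e -> exists T, F [set S | opnorm (T - S) < e].
  move=> e0; have eC : (0 : R[i]) < e%:C by rewrite ltcR.
  have /cauchyP /(_ _ eC)[T FT] := Fc; exists T.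
  apply: filterS FT => S; rewrite -ball_normE /=.
  by rewrite bop_normE ltcR.
have bopB (S T : 'L(H)) x : S x - T x = (S - T) x.
  by rewrite /= scaleN1r.
have evc x : exists y : H, (fun T : 'L(H) => T x) @ F --> y.
  apply/cvg_ex; apply: cauchy_cvg; apply/cauchy_exP => e e0.
  have eE : e = (Re e)%:C by rewrite RRe_real// gtr0_real.
  have re0 : 0 < Re e by rewrite -ltcR -eE.
  have x1 : 0 < nrm x + 1 by rewrite ltr_wpDl ?nrm_ge0.
  have [T FT] := Fe _ (divr_gt0 re0 x1); exists (T x).
  rewrite /= /nbhs/=; apply: filterS FT => S /= TS.
  rewrite -ball_normE /= bopB eE -nrmE ltcR.
  apply: (le_lt_trans (le_opnorm _ x)).
  rewrite (@le_lt_trans _ _ (Re e / (nrm x + 1) * nrm x))//.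
    by rewrite ler_wpM2r ?nrm_ge0// ltW.
  by rewrite mulrAC ltr_pdivrMr// ltr_pM2l// ltrDl.
have [L FL] := choice evc.
have Llin : linear L.
  move=> k x y; apply: (@cvg_unique _ (@norm_hausdorff _ H) _ _ _ _ (FL _)).
  rewrite (_ : (fun T : 'L(H) => T (k *: x + y)) = (fun T => k *: T x + T y)).
    by apply: cvgD; [apply: cvgZl_tmp|]; exact: FL.
  by apply/funext => T; rewrite linearP.
have LT (e : R) T : 0 < e -> F [set S | opnorm (T - S) < e] ->
    forall x, nrm (T x - L x) <= e * nrm x.
  move=> e0 FT x; apply/ler_addgt0Pr => d d0.
  have dC : (0 : R[i]) < d%:C by rewrite ltcR.
  have /cvgrPdist_lt/(_ _ dC) FS := FL x.
  have [S [/= TS]] := @filter_ex _ _ FF _ (filterI FT FS).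
  rewrite -nrmE ltcR => SL.
  have -> : T x - L x = (T - S) x - (L x - S x) by rewrite -bopB opprB addrA subrK.
  rewrite (le_trans (nrmD _ _))// lerD//; last by rewrite nrmN ltW.
  by rewrite (le_trans (le_opnorm _ _))// ler_wpM2r ?nrm_ge0// ltW.
pose Ll : {linear H -> H} := HB.pack L (GRing.isLinear.Build _ _ _ _ L Llin).
have Lcont : continuous L.
  have [T FT] := Fe 1 ltr01; have [M M0 TM] := bop_bound T.
  apply: (@bound_continuous _ _ _ Ll (M + 1)) => x /=.
  rewrite -[L x](subKr (T x)) (le_trans (nrmD _ _))// mulrDl lerD ?TM// nrmN.
  exact: LT.
apply/cvg_ex; exists (BoundedOp Llin Lcont).
apply/fcvgrPdist_lt => e e0.
have eE : e = (Re e)%:C by rewrite RRe_real// gtr0_real.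
have re0 : 0 < Re e by rewrite -ltcR -eE.
have e2 : 0 < Re e / 2 by rewrite divr_gt0.
have [T FT] := Fe _ e2; apply: filterS (FT) => S /= TS.
rewrite eE -(subrK T (BoundedOp _ _)) -addrA (le_lt_trans (ler_normD _ _))//.
rewrite !bop_normE -CD ltcR [ltRHS]splitr ler_ltD//.
apply: opnorm_le => [|x]; first exact: ltW.
by rewrite -bopB -nrmN opprB/=; exact: LT.
Qed.

HB.instance Definition _ := Uniform_isComplete.Build 'L(H) bop_complete.

End BoundedOpComplete.

Section Adjoint.
Variables (R : realType) (H : hilbertType R).
Implicit Types (S T : 'L(H)) (x y : H) (k : R[i]).

Fact adjoint_exists T y : exists z, forall x, inner (T x) y = inner x z.
Proof.
apply: (@riesz _ _ (fun x => inner (T x) y) (opnorm T * nrm y)).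
- by move=> a u v; rewrite linearP inner_linear.
- move=> x; rewrite (le_trans (cauchy_schwarz _ _))// -!nrmE -!CM lecR.
  by rewrite mulrAC ler_wpM2r ?nrm_ge0// le_opnorm.
- by rewrite mulr_ge0 ?opnorm_ge0 ?nrm_ge0.
Qed.

Definition adjoint_fun T y : H := sval (cid (adjoint_exists T y)).

Lemma adjoint_funE T x y : inner (T x) y = inner x (adjoint_fun T y).
Proof. exact: svalP (cid (adjoint_exists T y)) x. Qed.

Lemma inner_inj y z : (forall x, inner x y = inner x z) -> y = z.
Proof.
move=> yz; apply/eqP; rewrite -subr_eq0 -normr_eq0 -sqrf_eq0 -inner_norm.
by rewrite innerDr innerNr yz subrr.
Qed.

Fact adjoint_linear T : linear (adjoint_fun T).
Proof.
move=> k x y; apply: inner_inj => z.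
by rewrite -adjoint_funE !(innerDr, innerZr) !adjoint_funE.
Qed.

Fact adjoint_bound T y : nrm (adjoint_fun T y) <= opnorm T * nrm y.
Proof.
set z := adjoint_fun T y.
have [z0|z0] := eqVneq (nrm z) 0.
  by rewrite z0 mulr_ge0 ?opnorm_ge0 ?nrm_ge0.
have zp : 0 < nrm z by rewrite lt_def z0 nrm_ge0.
rewrite -(ler_pM2l zp) -expr2 -rinxx /rin -adjoint_funE.
apply: (le_trans (rin_le _ _)).
by rewrite mulrA ler_wpM2r ?nrm_ge0// mulrC le_opnorm.
Qed.

Fact adjoint_continuous T : continuous (adjoint_fun T).
Proof.
pose f : {linear H -> H} := HB.pack (adjoint_fun T)
  (GRing.isLinear.Build _ _ _ _ (adjoint_fun T) (@adjoint_linear T)).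
exact: (@bound_continuous _ _ _ f _ (adjoint_bound T)).
Qed.

Definition adjoint T := BoundedOp (@adjoint_linear T) (@adjoint_continuous T).

Lemma adjointE T x y : inner (T x) y = inner x (adjoint T y).
Proof. exact: adjoint_funE. Qed.

Lemma adjointP S T : (forall x y, inner (T x) y = inner x (S y)) -> adjoint T = S.
Proof.
move=> TS; apply: bopP => y; apply: inner_inj => x.
by rewrite -adjointE TS.
Qed.

Fact adjointK : involutive adjoint.
Proof.
by move=> T; apply: adjointP => x y; rewrite inner_conj -adjointE -inner_conj.
Qed.

Fact adjointD S T : adjoint (S + T) = adjoint S + adjoint T.
Proof.
by apply: adjointP => x y /=; rewrite innerDl innerDr !adjoint_funE.
Qed.

Fact adjointZ k T : adjoint (k *: T) = Num.conj k *: adjoint T.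
Proof.
by apply: adjointP => x y /=; rewrite innerZl innerZr conjCK adjoint_funE.
Qed.

Fact adjointM S T :
  adjoint (bop_comp S T) = bop_comp (adjoint T) (adjoint S).
Proof. by apply: adjointP => x y /=; rewrite !adjoint_funE. Qed.

Fact bop_normM S T : `|bop_comp S T| <= `|S| * `|T|.
Proof.
rewrite !bop_normE -CM lecR; apply: opnorm_le => [|x].
  by rewrite mulr_ge0 ?opnorm_ge0.
by rewrite (le_trans (le_opnorm S (T x)))// -mulrA ler_wpM2l ?opnorm_ge0 ?le_opnorm.
Qed.

Fact bop_cstar T : `|bop_comp (adjoint T) T| = `|T| ^+ 2.
Proof.
have adj_le S : opnorm (adjoint S) <= opnorm S.
  by apply: opnorm_le; [exact: opnorm_ge0|exact: adjoint_bound].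
apply/eqP; rewrite eq_le; apply/andP; split.
  rewrite (le_trans (bop_normM _ _))// expr2 !bop_normE -!CM lecR.
  by rewrite ler_wpM2r ?opnorm_ge0.
rewrite !bop_normE -CX2 lecR; set c := opnorm (bop_comp _ _).
have c0 : 0 <= c := opnorm_ge0 _.
suff : opnorm T <= Num.sqrt c.
  by rewrite -(@ler_pXn2r _ 2)// ?nnegrE ?opnorm_ge0 ?sqrtr_ge0// sqr_sqrtr.
apply: opnorm_le => [|x]; first exact: sqrtr_ge0.
rewrite -(@ler_pXn2r _ 2)// ?nnegrE ?mulr_ge0 ?nrm_ge0 ?sqrtr_ge0//.
rewrite exprMn sqr_sqrtr// -rinxx /rin adjoint_funE.
apply: (le_trans (rin_le _ _)).
rewrite mulrC expr2 mulrA ler_wpM2r ?nrm_ge0//.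
exact: (le_opnorm (bop_comp (adjoint T) T) x).
Qed.

Fact bop_compA : associative (@bop_comp R H).
Proof. by move=> S T U; apply: bopP. Qed.
Fact bop_comp1l : left_id (@bop_one R H) (@bop_comp R H).
Proof. by move=> S; apply: bopP. Qed.
Fact bop_comp1r : right_id (@bop_one R H) (@bop_comp R H).
Proof. by move=> S; apply: bopP. Qed.
Fact bop_compDl : left_distributive (@bop_comp R H) +%R.
Proof. by move=> S T U; apply: bopP. Qed.
Fact bop_compDr : right_distributive (@bop_comp R H) +%R.
Proof. by move=> S T U; apply: bopP => x /=; rewrite linearD. Qed.
Fact bop_scaleAl k S T : k *: bop_comp S T = bop_comp (k *: S) T.
Proof. exact: bopP. Qed.
Fact bop_scaleAr k S T : k *: bop_comp S T = bop_comp S (k *: T).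
Proof. by apply: bopP => x /=; rewrite linearZ. Qed.

HB.instance Definition _ := isCStarAlgebra.Build R 'L(H)
  bop_compA bop_comp1l bop_comp1r bop_compDl bop_compDr bop_scaleAl bop_scaleAr
  bop_normM adjointK adjointD adjointZ adjointM bop_cstar.
HB.instance Definition _ := GRing.PzRing.copy 'L(H)
  (CStarAlgebra.sort 'L(H)).

End Adjoint.

Lemma bop_mulE (R : realType) (H : hilbertType R) (S T : 'L(H)) (x : H) :
  (S * T) x = S (T x).
Proof. by []. Qed.

Lemma inner_starE (R : realType) (H : hilbertType R) (T : 'L(H)) (x y : H) :
  inner (T x) y = inner x (star T y).
Proof. exact: adjointE. Qed.

(* *-homomorphisms; not required to be unital *)
Definition star_morphism (R : realType) (A B : cstarAlgType R) (f : A -> B) :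
  Prop :=
  [/\ linear f, {morph f : x y / x * y} & {morph f : x / star x}].

(* Closed two-sided ideals; stability under scalars follows from the last
   condition, since A is unital. *)
Definition closed_ideal (R : realType) (A : cstarAlgType R) (J : set A) : Prop :=
  [/\ closed J, J 0, forall x y, J x -> J y -> J (x + y)
    & forall a x, J x -> J (a * x) /\ J (x * a)].

Definition cstar_subalgebra (R : realType) (B : cstarAlgType R) (S : set B) :
  Prop :=
  [/\ closed S, S 0,
      forall (k : R[i]) x y, S x -> S y -> S (k *: x + y),
      forall x y, S x -> S y -> S (x * y)
    & forall x, S x -> S (star x)].

Definition cstar_generated (R : realType) (B : cstarAlgType R) (X : set B) :
  set B := smallest (@cstar_subalgebra R B) X.

(* Only the restriction of f to S1 matters. *)
Definition star_isomorphism (R : realType) (B1 B2 : cstarAlgType R)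
    (S1 : set B1) (S2 : set B2) (f : B1 -> B2) : Prop :=
  [/\ set_bij S1 S2 f,
      forall (k : R[i]) x y, S1 x -> S1 y -> f (k *: x + y) = k *: f x + f y,
      forall x y, S1 x -> S1 y -> f (x * y) = f x * f y
    & forall x, S1 x -> f (star x) = star (f x)].

Section Representation.
Variables (R : realType) (A : cstarAlgType R) (alpha : A -> A).
Variables (H : hilbertType R) (pi : A -> 'L(H)) (U : 'L(H)).

Record representation : Prop := Representation {
  rep_morphism : star_morphism pi;
  rep_unital : pi 1 = 1;
  rep_endo : forall a, U * pi a * star U = pi (alpha a)
}.

Definition faithful_representation : Prop := representation /\ injective pi.

Definition covariant (J : set A) : Prop :=
  J = [set a | star U * U * pi a = pi a].

(* Both sums have finite support under the first hypothesis on a, so that they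
   are not subject to the convention that a sum of infinite support is 0. *)
Definition property_star : Prop :=
  forall a : nat -> nat -> A,
    finite_set [set p : nat * nat | a p.1 p.2 != 0] ->
    (forall m n, exists b, a m n = iter m alpha 1 * b * iter n alpha 1) ->
    `|\sum_(m \in [set: nat]) star U ^+ m * pi (a m m) * U ^+ m| <=
    `|\sum_(p \in [set: nat * nat])
        star U ^+ p.1 * pi (a p.1 p.2) * U ^+ p.2|.

(* the C*-algebra C*(pi(A), U) *)
Definition cstar_of_representation : set 'L(H) :=
  cstar_generated (range pi `|` [set U]).

End Representation.

(* Main.v *)
(** By the C*-identity, the norm of a word sum [x = sum U^*m pi(a_mn) U^n] is
    recovered from the degree-0 parts of the powers of [x^* x]: a sum of [K]
    homogeneous components satisfies [|x|^2 <= K |(x^* x)_0|], property (star)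
    bounds [|(x^* x)_0|] by [|x|^2], and the factor [K], which grows linearly
    with the exponent, disappears on taking roots.  The projection [Q = U^* U]
    commutes with [pi A] and splits a degree-0 sum into the compression
    [pi(a_0) (1 - Q)] and [U^* Y U], with [Y] a shorter degree-0 sum of the same
    norm as [U^* Y U].  So its norm is determined by those of [pi(a)] and
    [pi(a) (1 - Q)].  These are *-morphisms with kernels [0] and [J], and the
    norm of the image under a *-morphism depends only on its kernel. *)

Require Import Defs.
From mathcomp Require Import all_boot order ssralg ssrnum archimedean complex.
From mathcomp Require Import boolp classical_sets functions cardinality fsbigop.
From mathcomp Require Import reals topology normedtype.
From mathcomp Require Import zify ring lra.

Set Implicit Arguments.
Unset Strict Implicit.
Unset Printing Implicit Defensive.

Import Order.TTheory GRing.Theory Num.Theory.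
Import numFieldNormedType.Exports.

Local Open Scope classical_set_scope.
Local Open Scope complex_scope.
Local Open Scope ring_scope.

(** * Square roots in C*-algebras *)

Section RealValuedNorm.
Variables (R : realType) (V : normedModType R[i]).
Implicit Types (x y : V) (t : R).

Lemma nrmB x y : nrm (x - y) = nrm (y - x).
Proof. by rewrite -nrmN opprB. Qed.

Lemma nrm_triangle y x z : nrm (x - z) <= nrm (x - y) + nrm (y - z).
Proof. by rewrite (le_trans _ (nrmD _ _))// addrA subrK. Qed.

Lemma nrmZ_ge0 t x : 0 <= t -> nrm (t%:C *: x) = t * nrm x.
Proof. by move=> t0; rewrite nrmZ normC_real /= ger0_norm. Qed.

Lemma nrm_sum (I : Type) (r : seq I) (P : pred I) (F : I -> V) :
  nrm (\sum_(i <- r | P i) F i) <= \sum_(i <- r | P i) nrm (F i).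
Proof.
elim/big_ind2: _ => [|x s y t xs yt|//]; first by rewrite nrm0.
by rewrite (le_trans (nrmD _ _))// lerD.
Qed.

(** The constant [c] lets a limit argument end with a bound such as [e * 4], with no rescaling of
    [e] beforehand. *)
Lemma nrm_small_eq0 x (c : R) :
  (forall e : R, 0 < e -> nrm x <= e * c) -> x = 0.
Proof.
move=> xe; apply: nrm0_eq0; apply/eqP; rewrite eq_le nrm_ge0 andbT.
apply/ler_addgt0Pr => e e0; rewrite add0r.
have c0 : 0 <= c by have := xe 1 ltr01; rewrite mul1r; apply/le_trans/nrm_ge0.
have c1 : 0 < c + 1 by rewrite ltr_wpDl.
rewrite (le_trans (xe (e / (c + 1)) _)) ?divr_gt0//.
by rewrite mulrAC ler_pdivrMr// ler_wpM2l ?(ltW e0)// lerDl.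
Qed.

Lemma closed_nrmP (S : set V) x : closed S ->
  (forall e : R, 0 < e -> exists2 y, S y & nrm (x - y) < e) -> S x.
Proof.
move=> Scl xS; apply: Scl => B /nbhs_ballP[e /= e0 eB].
have eE : e = (complex.Re e)%:C by rewrite RRe_real// gtr0_real.
have [|y Sy xy] := xS (complex.Re e); first by rewrite -ltcR -eE.
exists y; split=> //; apply: eB.
by rewrite -ball_normE /= -nrmE eE ltcR.
Qed.

Lemma nrm_closed (S : set V) :
  (forall x, (forall e : R, 0 < e -> exists2 y, S y & nrm (x - y) < e) ->
     S x) ->
  closed S.
Proof.
move=> SP x xS; apply: SP => e e0.
have [|y [Sy]] := xS (ball x e%:C); first by apply: nbhsx_ballx; rewrite ltcR.
by rewrite -ball_normE /= -nrmE ltcR; exists y.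
Qed.

End RealValuedNorm.

Section SequentialCompleteness.
Variables (R : realType) (V : completeNormedModType R[i]).

Lemma nrm_cauchy_cvg (u : nat -> V) :
  (forall e : R, 0 < e -> exists N : nat,
     forall m n, (N <= m)%N -> (N <= n)%N -> nrm (u m - u n) < e) ->
  exists l, forall e : R, 0 < e -> exists N : nat,
     forall n, (N <= n)%N -> nrm (l - u n) < e.
Proof.
move=> uC.
have Re0 (e : R[i]) : 0 < e -> e = (complex.Re e)%:C /\ 0 < complex.Re e.
  move=> e0; have eE : e = (complex.Re e)%:C by rewrite RRe_real// gtr0_real.
  by rewrite -ltcR -eE.
have : cvg (u @ \oo).
  apply: cauchy_cvg; apply/cauchy_exP => e /Re0[eE e0].
  have [N uN] := uC _ e0; exists (u N); exists N => // n /= Nn.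
  by rewrite -ball_normE /= -nrmE eE ltcR; apply: uN.
move/cvg_ex => [l /cvgrPdist_lt ul]; exists l => e e0.
have eC : (0 : R[i]) < e%:C by rewrite ltcR.
have [N _ Nul] := ul _ eC; exists N => n Nn.
by rewrite -ltcR nrmE; apply: Nul.
Qed.

End SequentialCompleteness.

Lemma bounded_incr_cauchy (R : realType) (t : nat -> R) (M : R) :
  (forall n, t n <= t n.+1) -> (forall n, t n <= M) ->
  forall e : R, 0 < e -> exists N : nat,
    forall m n, (N <= m)%N -> (N <= n)%N -> `|t m - t n| < e.
Proof.
move=> tS tM e e0.
have tmon : {homo t : m n / (m <= n)%N >-> m <= n}.
  by apply: homo_leq => // y x z; exact: le_trans.
have tsup : has_sup (range t).
  by split; [exists (t 0), 0%N | exists M => _ [n _ <-]].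
have tle n : t n <= sup (range t) by apply: sup_upper_bound => //; exists n.
have [_ [N _ <-] tN] := sup_adherent e0 tsup; exists N => m n Nm Nn.
have := tle m; have := tle n; have := tmon _ _ Nm; have := tmon _ _ Nn.
by move=> *; rewrite ltr_norml; apply/andP; split; lra.
Qed.

Section CStarTheory.
Variables (R : realType) (A : cstarAlgType R).
Implicit Types (x y z w : A) (k : R[i]).

Lemma scaleM_l k x y : (k *: x) * y = k *: (x * y).
Proof. exact/esym/cscalerAl. Qed.

Lemma scaleM_r k x y : x * (k *: y) = k *: (x * y).
Proof. exact/esym/cscalerAr. Qed.

Lemma starMr x y : star (x * y) = star y * star x.
Proof. exact: starM. Qed.

Lemma star0 : star (0 : A) = 0.
Proof. by apply: (addIr (star 0)); rewrite -starD !add0r. Qed.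

Lemma starN x : star (- x) = - star x.
Proof. by apply: (addIr (star x)); rewrite -starD !addNr star0. Qed.

Lemma starB x y : star (x - y) = star x - star y.
Proof. by rewrite starD starN. Qed.

Lemma star1 : star (1 : A) = 1.
Proof. by rewrite -[LHS]mulr1 -{2}[1]starK -starMr mulr1 starK. Qed.

Lemma starX x n : star (x ^+ n) = star x ^+ n.
Proof.
by elim: n => [|n IH]; rewrite ?expr0 ?star1// exprS starMr IH exprSr.
Qed.

Lemma star_sum (I : Type) (r : seq I) (P : pred I) (F : I -> A) :
  star (\sum_(i <- r | P i) F i) = \sum_(i <- r | P i) star (F i).
Proof. exact: (big_morph _ starD star0). Qed.

Lemma starZr (t : R) x : star (t%:C *: x) = t%:C *: star x.
Proof. by rewrite starZ conj_Creal// complex_real. Qed.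

Lemma nrmM x y : nrm (x * y) <= nrm x * nrm y.
Proof. by rewrite -lecR CM !nrmE; exact: cnormM. Qed.

Lemma nrm_starM x : nrm (star x * x) = nrm x ^+ 2.
Proof. by apply: complexI; rewrite CX2 !nrmE; exact: cstar_norm. Qed.

Lemma nrm_star x : nrm (star x) = nrm x.
Proof.
have le y : nrm y <= nrm (star y).
  have [->|y0] := eqVneq (nrm y) 0; first exact: nrm_ge0.
  have yp : 0 < nrm y by rewrite lt_def y0 nrm_ge0.
  by rewrite -(ler_pM2r yp) -expr2 -nrm_starM nrmM.
by apply/eqP; rewrite eq_le le andbT -{2}[x]starK le.
Qed.

Lemma nrm_Mstar x : nrm (x * star x) = nrm x ^+ 2.
Proof. by rewrite -{1}[x]starK nrm_starM nrm_star. Qed.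

Lemma starM_eq0 x : star x * x = 0 -> x = 0.
Proof.
move=> x0; apply: nrm0_eq0; apply/eqP; rewrite -sqrf_eq0 -nrm_starM.
by rewrite x0 nrm0.
Qed.

Lemma nrm_proj_le1 x : star x = x -> x * x = x -> nrm x <= 1.
Proof.
move=> xs xx; have := nrm_starM x; rewrite xs xx => /esym/eqP.
rewrite expr2 -subr_eq0 -{3}[nrm x]mulr1 -mulrBr mulf_eq0 => /orP[/eqP->//|].
by rewrite subr_eq0 => /eqP->.
Qed.

Lemma nrm1_le1 : nrm (1 : A) <= 1.
Proof. by apply: nrm_proj_le1; rewrite ?star1 ?mulr1. Qed.

Lemma nrm_selfadjX2 x (k : nat) : star x = x ->
  nrm (x ^+ (2 ^ k)) = nrm x ^+ (2 ^ k).
Proof.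
move=> xs; elim: k => [|k IH]; first by rewrite !expr1.
by rewrite expnSr !exprM -IH -nrm_starM starX xs expr2.
Qed.

(* Visser's iteration y_(n+1) = (x + y_n ^ 2) / 2 for 1 - sqrt(1 - x): its
   increments are dominated by those of the scalar case x = 1. *)
Lemma selfadjoint_one_minus_sqrt x : star x = x -> nrm x <= 1 ->
  exists y, [/\ star y = y, nrm y <= 1, y + y = x + y * y
    & forall w, w * x = x * w -> w * y = y * w].
Proof.
move=> xs x1.
pose u := fix u n :=
  if n is n'.+1 then (2^-1)%:C *: (x + u n' * u n') else 0 : A.
pose t := fix t n := if n is n'.+1 then (1 + t n' ^+ 2) / 2 else 0 : R.
have half (y : A) : (2^-1)%:C *: (y + y) = y.
  rewrite -[X in X + X]scale1r -scalerDl scalerA -CD -CM.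
  by rewrite -[1 + 1]/(2%:R) mulVf ?pnatr_eq0// scale1r.
have t01 n : 0 <= t n /\ t n <= 1.
  by elim: n => [|n [a b]] /=; [split|have := sqr_ge0 (t n); split; nra].
have tS n : t n <= t n.+1 by move: (sqr_ge0 (t n - 1)) => /=; nra.
have ucomm n w : w * x = x * w -> w * u n = u n * w.
  move=> wx; elim: n => [|n IH] /=; first by rewrite mulr0 mul0r.
  by rewrite scaleM_l scaleM_r mulrDl mulrDr wx mulrA IH -mulrA IH mulrA.
have uux m n : u m * u n = u n * u m by apply: (ucomm n); apply/esym/ucomm.
have us n : star (u n) = u n.
  by elim: n => [|n IH] /=; rewrite ?star0// starZr starD starMr IH xs.
have un n : nrm (u n) <= t n.
  elim: n => [|n IH] /=; first by rewrite nrm0.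
  rewrite nrmZ_ge0 ?invr_ge0// mulrC ler_wpM2r ?invr_ge0//.
  rewrite (le_trans (nrmD _ _))// lerD// (le_trans (nrmM _ _))// expr2.
  by rewrite ler_pM ?nrm_ge0.
have ud n : nrm (u n.+1 - u n) <= t n.+1 - t n.
  elim: n => [|n IH]; first by rewrite !subr0 (un 1%N).
  (* The iterates commute, so the difference of their squares factors. The scalar sequence factors
     in the same way, and the bounds on [u] and on the previous increment carry over factor by
     factor. *)
  have -> : u n.+2 - u n.+1 = (2^-1)%:C *: ((u n.+1 - u n) * (u n.+1 + u n)).
    rewrite [LHS]/= -scalerBr; congr (_ *: _).
    rewrite opprD addrACA subrr add0r -/(u n.+1) mulrDr !mulrBl (uux n n.+1).
    by rewrite addrA subrK.
  have -> : t n.+2 - t n.+1 = 2^-1 * ((t n.+1 - t n) * (t n.+1 + t n)).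
    by rewrite [t n.+2]/= -/(t n.+1) [X in _ - X]/=; field.
  rewrite nrmZ_ge0 ?invr_ge0// ler_wpM2l ?invr_ge0//.
  rewrite (le_trans (nrmM _ _))// ler_pM ?nrm_ge0//.
  by rewrite (le_trans (nrmD _ _))// lerD.
have udk n (k : nat) : nrm (u (n + k)%N - u n) <= t (n + k)%N - t n.
  elim: k => [|k IH]; first by rewrite addn0 !subrr nrm0.
  rewrite addnS (le_trans (nrm_triangle (u (n + k)%N) _ _))//.
  have := ud (n + k)%N; move: IH; lra.
have udmn m n : nrm (u m - u n) <= `|t m - t n|.
  wlog mn : m n / (n <= m)%N.
    move=> W; case/orP: (leq_total n m) => [/W//|/W].
    by rewrite nrmB distrC.
  by rewrite -(subnKC mn) (le_trans (udk _ _))// ler_norm.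
have [e e0|l ul] := @nrm_cauchy_cvg R A u.
  have [N tN] := bounded_incr_cauchy tS (fun n => (t01 n).2) e0.
  by exists N => m n Nm Nn; rewrite (le_lt_trans (udmn _ _))// tN.
have uclose (e : R) : 0 < e ->
    exists n, nrm (l - u n) < e /\ nrm (l - u n.+1) < e.
  by move=> /ul[N uN]; exists N; split; apply: uN.
have l1 : nrm l <= 1.
  apply/ler_addgt0Pr => e /uclose[n [ln _]].
  have := nrmD (l - u n) (u n); rewrite subrK => /le_trans; apply.
  by rewrite addrC lerD ?(ltW ln)// (le_trans (un n))// (t01 n).2.
exists l; split=> //.
- apply/subr0_eq/(@nrm_small_eq0 _ _ _ 2) => e /uclose[n [ln _]].
  rewrite (le_trans (nrm_triangle (u n) _ _))// -{1}(us n) -starB nrm_star.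
  by rewrite (nrmB (u n)); lra.
- apply/subr0_eq/(@nrm_small_eq0 _ _ _ 4) => e /uclose[n [ln lSn]].
  have uE : u n.+1 + u n.+1 = x + u n * u n.
    by rewrite /= -scalerDr half.
  (* The defect of the limit in the fixed-point equation is written through [l - u n] and
     [l - u n.+1]; its four terms are each at most [e] in norm. *)
  have -> : l + l - (x + l * l) =
      (l - u n.+1) + (l - u n.+1) - ((l - u n) * l + u n * (l - u n)).
    have uB : - u n.+1 - u n.+1 = - (x + u n * u n) by rewrite -uE opprD.
    rewrite (addrACA l) uB -[RHS]addrA; congr (_ + _).
    rewrite mulrBl mulrBr [l * l - _ + _]addrA subrK.
    apply: oppr_inj; rewrite opprK [RHS]opprD !opprK -addrA.
    by rewrite [u n * u n + _]addrC subrK.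
  have h1 : nrm ((l - u n) * l) <= e.
    by rewrite (le_trans (nrmM _ _))// -[e]mulr1 ler_pM ?nrm_ge0 ?(ltW ln).
  have h2 : nrm (u n * (l - u n)) <= e.
    rewrite (le_trans (nrmM _ _))// -[e]mul1r ler_pM ?nrm_ge0 ?(ltW ln)//.
    by rewrite (le_trans (un n))// (t01 n).2.
  have := nrmD ((l - u n) * l) (u n * (l - u n)).
  have := nrmD (l - u n.+1) (l - u n.+1).
  have := nrmD (l - u n.+1 + (l - u n.+1))
    (- ((l - u n) * l + u n * (l - u n))).
  rewrite nrmN; lra.
- move=> w wx; apply/subr0_eq/(@nrm_small_eq0 _ _ _ (2 * nrm w)) => e.
  move=> /uclose[n [ln _]].
  have -> : w * l - l * w = w * (l - u n) - (l - u n) * w.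
    by rewrite mulrBr mulrBl ucomm// opprB addrA subrK.
  rewrite (le_trans (nrmD _ _))// nrmN.
  have := nrmM w (l - u n); have := nrmM (l - u n) w.
  have : nrm w * nrm (l - u n) <= nrm w * e by rewrite ler_wpM2l ?nrm_ge0// ltW.
  rewrite (mulrC (nrm (l - u n))) => *; lra.
Qed.

End CStarTheory.

(** * Kernels and norms of *-morphisms *)

Section AbsoluteValue.
Variables (R : realType) (A : cstarAlgType R).
Implicit Types (x y z p w : A).

(** The fixed-point equation [y + y = x + y * y] is a completed square. The root is kept in the form
    [1 - y] with [nrm y <= 1], from which [smorph_one_minus_psd] reads off its positivity. *)
Lemma selfadjoint_sqrt_one_minus x : star x = x -> nrm x <= 1 ->
  exists y, [/\ star y = y, nrm y <= 1, (1 - y) * (1 - y) = 1 - x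
    & forall w, w * x = x * w -> w * y = y * w].
Proof.
move=> xs x1; have [y [ys y1 yy yc]] := selfadjoint_one_minus_sqrt xs x1.
exists y; split=> //; rewrite mulrBl mul1r mulrBr mulr1 opprB addrA.
have -> : x = y + y - y * y by rewrite yy addrK.
by rewrite opprB opprD !addrA (addrAC 1).
Qed.

(* With [p] the square root of [1 - z ^ 2], the element [z + i p] is unitary,
   so [p] is its imaginary part and has norm at most 1. *)
Lemma nrm_one_minus_sqr z : star z = z -> nrm z <= 1 -> nrm (1 - z * z) <= 1.
Proof.
move=> zs z1.
have zzs : star (z * z) = z * z by rewrite starMr zs.
have zz1 : nrm (z * z) <= 1.
  by rewrite (le_trans (nrmM _ _))// -[1]mulr1 ler_pM ?nrm_ge0.
have [y [ys y1 yy yc]] := selfadjoint_sqrt_one_minus zzs zz1.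
pose p := 1 - y; rewrite -yy -/p.
have ps : star p = p by rewrite starB star1 ys.
have zp : z * p = p * z by rewrite mulrBr mulrBl mulr1 mul1r yc// mulrA.
pose u := z + 'i *: p.
have us : star u = z - 'i *: p.
  by rewrite starD starZ zs ps conjCi scaleNr.
have ii : ('i : R[i]) * 'i = -1 by rewrite -expr2; exact: sqr_i.
have uu : star u * u = 1.
  rewrite us mulrDr !mulrBl !scaleM_l !scaleM_r scalerA ii scaleN1r.
  by rewrite zp opprK addrA subrK [p * p]yy addrC subrK.
have u1 : nrm u <= 1.
  rewrite -(@ler_pXn2r _ 2)// ?nnegrE ?nrm_ge0// expr1n -nrm_starM uu.
  exact: nrm1_le1.
have p1 : nrm p <= 1.
  have upE : ((2%:C : R[i]) * 'i) *: p = u - star u.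
    by rewrite us opprB addrC addrA subrK -scalerA (CD 1 1) scalerDl !scale1r.
  have := nrmD u (- star u); rewrite nrmN nrm_star -upE nrmZ normrM normC_real.
  have -> : `|'i : R[i]| = 1 by exact: normCi.
  by rewrite mulr1 /= normr_nat; lra.
by rewrite (le_trans (nrmM _ _))// -[1]mulr1 ler_pM ?nrm_ge0.
Qed.

(** Here [1 - y] is the absolute value of [z], obtained as the square root of [1 - x] for
    [x = 1 - z * z]. *)
Lemma selfadjoint_abs z : star z = z -> nrm z <= 1 ->
  exists y, [/\ star y = y, nrm y <= 1, (1 - y) * (1 - y) = z * z
    & z * y = y * z].
Proof.
move=> zs z1.
have xs : star (1 - z * z) = 1 - z * z by rewrite starB star1 starMr zs.
have [y [ys y1 yy yc]] :=
  selfadjoint_sqrt_one_minus xs (nrm_one_minus_sqr zs z1).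
exists y; split=> //; first by rewrite yy opprB addrC subrK.
by apply: yc; rewrite mulrBr mulrBl mulr1 mul1r mulrA.
Qed.

End AbsoluteValue.

Section PositiveOperators.
Variables (R : realType) (H : hilbertType R).
Implicit Types (S T P Z : 'L(H)) (h g : H).

(** Since [rin] is a real part, this does not entail self-adjointness, which is assumed separately
    where it matters. *)
Definition psd T := forall h, 0 <= rin (T h) h.

Lemma rin_starE T h g : rin (T h) g = rin h (star T g).
Proof. by rewrite /rin inner_starE. Qed.

Lemma rin_starM T h : rin ((star T * T) h) h = nrm (T h) ^+ 2.
Proof. by rewrite bop_mulE -rinxx [RHS]rin_starE rinC. Qed.

Lemma bopD S T h : (S + T) h = S h + T h. Proof. by []. Qed.

Lemma bopN T h : (- T) h = - T h. Proof. by rewrite /= scaleN1r. Qed.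

Lemma bopB S T h : (S - T) h = S h - T h. Proof. by rewrite bopD bopN. Qed.

Lemma bopZ (k : R[i]) T h : (k *: T) h = k *: T h. Proof. by []. Qed.

Lemma bop_appD T h g : T (h + g) = T h + T g. Proof. exact: linearD. Qed.

Lemma bop0 h : (0 : 'L(H)) h = 0. Proof. by []. Qed.

(** Polarization: both cross terms of the form at [h + T h] equal [nrm (T h) ^+ 2]. *)
Lemma selfadjoint_form_eq0 T :
  star T = T -> (forall h, rin (T h) h = 0) -> T = 0.
Proof.
move=> Ts T0; apply: bopP => h; rewrite bop0; apply: nrm0_eq0.
suff: rin (T h) (T h) = 0 by rewrite rinxx => /eqP; rewrite sqrf_eq0 => /eqP.
have TT : rin (T (T h)) h = rin (T h) (T h) by rewrite rin_starE Ts.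
have := T0 (h + T h); rewrite bop_appD !(rinDl, rinDr) !T0 TT add0r addr0.
by move/eqP; rewrite -mulr2n mulrn_eq0 => /eqP.
Qed.

(** Uniqueness of the positive square root. For [D = P - Z] one has [(P + Z) * D = 0], so the
    nonnegative forms of [P] and [Z] at [D h] add up to 0 and both vanish. Their difference is the
    form of [D * D * D] at [h]; hence the cube of [D] is 0, and the C*-identity gives [D = 0]. *)
Lemma psd_sqr_inj P Z : star P = P -> star Z = Z -> psd P -> psd Z ->
  P * Z = Z * P -> P * P = Z * Z -> P = Z.
Proof.
move=> Ps Zs P0 Z0 PZ PP; pose D := P - Z.
have Ds : star D = D by rewrite starB Ps Zs.
have SD : (P + Z) * D = 0 by rewrite mulrDl !mulrBr PP PZ addrA subrK subrr.
have form0 h : rin ((D * D * D) h) h = 0.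
  have := P0 (D h); have := Z0 (D h).
  have : rin (P (D h)) (D h) + rin (Z (D h)) (D h) = 0.
    by rewrite -rinDl -bopD -bop_mulE SD bop0 /rin inner0l.
  have -> : rin ((D * D * D) h) h = rin (D (D h)) (D h).
    by rewrite !bop_mulE rin_starE Ds.
  have -> : D (D h) = P (D h) - Z (D h) by rewrite -bopB.
  by rewrite rinDl rinNl; lra.
have D3 : D * D * D = 0.
  by apply: selfadjoint_form_eq0 form0; rewrite !starMr Ds mulrA.
have D4 : D ^+ (2 ^ 2)%N = 0.
  by rewrite (_ : (2 ^ 2)%N = 4%N)// !exprS expr0 mulr1 !mulrA D3 mul0r.
have := nrm_selfadjX2 2 Ds; rewrite D4 nrm0 => /esym/eqP.
rewrite expf_eq0 /= => /eqP/nrm0_eq0.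
exact: subr0_eq.
Qed.

End PositiveOperators.

Section StarMorphism.
Variables (R : realType) (A : cstarAlgType R) (B : cstarAlgType R).
Variables (phi : A -> B) (phiP : star_morphism phi).

Lemma smorph_scaleD k x y : phi (k *: x + y) = k *: phi x + phi y.
Proof. by case: phiP => + _ _; apply. Qed.

Lemma smorphD x y : phi (x + y) = phi x + phi y.
Proof. by have := smorph_scaleD 1 x y; rewrite !scale1r. Qed.

Lemma smorph0 : phi 0 = 0.
Proof. by apply: (addIr (phi 0)); rewrite -smorphD !add0r. Qed.

Lemma smorphZ k x : phi (k *: x) = k *: phi x.
Proof. by have := smorph_scaleD k x 0; rewrite smorph0 !addr0. Qed.

Lemma smorphN x : phi (- x) = - phi x.
Proof. by apply: (addIr (phi x)); rewrite -smorphD !addNr smorph0. Qed.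

Lemma smorphB x y : phi (x - y) = phi x - phi y.
Proof. by rewrite smorphD smorphN. Qed.

Lemma smorphM x y : phi (x * y) = phi x * phi y.
Proof. by case: phiP => _ + _; apply. Qed.

Lemma smorph_star x : phi (star x) = star (phi x).
Proof. by case: phiP => _ _; apply. Qed.

Lemma smorph_sum (I : Type) (r : seq I) (P : pred I) (F : I -> A) :
  phi (\sum_(i <- r | P i) F i) = \sum_(i <- r | P i) phi (F i).
Proof. exact: (big_morph _ smorphD smorph0). Qed.

End StarMorphism.

Section OperatorMorphism.
Variables (R : realType) (A : cstarAlgType R) (H : hilbertType R).
Variables (phi : A -> 'L(H)) (phiP : star_morphism phi).
Implicit Types (a y : A) (h : H).

(** The morphism need not be unital, as is the case for compressions by [1 - Q] later; the
    projection [phi 1] then takes the place of the identity operator. *)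
Let phiE a h : phi a h = phi a (phi 1 h).
Proof. by rewrite -bop_mulE -smorphM// mulr1. Qed.

Let phi1_form h : rin (phi 1 h) h = nrm (phi 1 h) ^+ 2.
Proof. by rewrite -rin_starM -smorph_star// star1 -smorphM// mulr1. Qed.

Let phi1_le h : nrm (phi 1 h) <= nrm h.
Proof.
have := rin_le (phi 1 h) h; rewrite phi1_form expr2.
have [->|h0] := eqVneq (nrm (phi 1 h)) 0; first by rewrite nrm_ge0.
by rewrite ler_pM2l// lt_def h0 nrm_ge0.
Qed.

Lemma smorph_form_one_minus a h :
  rin (phi (1 - star a * a) h) h = nrm (phi 1 h) ^+ 2 - nrm (phi a h) ^+ 2.
Proof.
rewrite smorphB// bopB rinDl rinNl phi1_form smorphM// smorph_star//.
by rewrite rin_starM.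
Qed.

(** [1 - star a * a] is the square of a self-adjoint element, so the form of its image is
    nonnegative; by [smorph_form_one_minus] that form is a difference of squared norms. *)
Lemma smorph_contraction a h : nrm a <= 1 -> nrm (phi a h) <= nrm h.
Proof.
move=> a1.
have xs : star (star a * a) = star a * a by rewrite starMr starK.
have x1 : nrm (star a * a) <= 1 by rewrite nrm_starM expr_le1 ?nrm_ge0.
have [y [ys _ yy _]] := selfadjoint_sqrt_one_minus xs x1.
apply: (le_trans _ (phi1_le h)).
rewrite -(@ler_pXn2r _ 2)// ?nnegrE ?nrm_ge0// -subr_ge0.
rewrite -smorph_form_one_minus -yy.
have -> : (1 - y) * (1 - y) = star (1 - y) * (1 - y) by rewrite starB star1 ys.
by rewrite smorphM// smorph_star// rin_starM sqr_ge0.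
Qed.

(** Cauchy-Schwarz on the range of [phi 1], on which [phi y] is a contraction. *)
Lemma smorph_one_minus_psd y : nrm y <= 1 -> psd (phi (1 - y)).
Proof.
move=> y1 h; rewrite smorphB// bopB rinDl rinNl phi1_form subr_ge0.
rewrite (phiE y) -[y]mul1r smorphM// bop_mulE rin_starE -smorph_star// star1.
rewrite (le_trans (rin_le _ _))// expr2 ler_wpM2r ?nrm_ge0//.
exact: smorph_contraction.
Qed.

(** Turns a norm bound into positivity of the image of one element of [A], the property that can be
    transferred between morphisms by comparing kernels. *)
Lemma smorph_nrm_le1P a :
  nrm (phi a) <= 1 <-> psd (phi (1 - star a * a)).
Proof.
split=> [a1 h|a0].
  rewrite smorph_form_one_minus subr_ge0 phiE.
  rewrite ler_pXn2r ?nnegrE ?nrm_ge0// (le_trans (le_opnorm _ _))//.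
  by rewrite ler_piMl ?nrm_ge0.
apply: opnorm_le => // h; rewrite mul1r (le_trans _ (phi1_le h))//.
rewrite -(@ler_pXn2r _ 2)// ?nnegrE ?nrm_ge0// -subr_ge0.
by rewrite -smorph_form_one_minus.
Qed.

End OperatorMorphism.

(* A multiple [z] of [1 - a^* a] is sent to a positive operator exactly when
   the morphism kills [|z| - z]. *)
Lemma smorph_kernel_nrm_le (R : realType) (A : cstarAlgType R)
    (H1 H2 : hilbertType R) (phi1 : A -> 'L(H1)) (phi2 : A -> 'L(H2)) :
  star_morphism phi1 -> star_morphism phi2 ->
  (forall a, phi1 a = 0 -> phi2 a = 0) ->
  forall a, nrm (phi2 a) <= nrm (phi1 a).
Proof.
move=> m1 m2 ker.
have le1 a : nrm (phi1 a) <= 1 -> nrm (phi2 a) <= 1.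
  move=> /(smorph_nrm_le1P m1); set w := 1 - _ => w0.
  apply/(smorph_nrm_le1P m2); rewrite -/w.
  have c1 : 0 < nrm w + 1 by rewrite ltr_wpDl ?nrm_ge0.
  pose c := (nrm w + 1)^-1; pose z := c%:C *: w.
  have c0 : 0 < c by rewrite invr_gt0.
  have zs : star z = z by rewrite starZr starB star1 starMr starK.
  have z1 : nrm z <= 1.
    by rewrite nrmZ_ge0 ?(ltW c0)// mulrC ler_pdivrMr// mul1r lerDl.
  have psdz (H : hilbertType R) (phi : A -> 'L(H)) : star_morphism phi ->
      psd (phi z) <-> psd (phi w).
    move=> mp; split=> + h => /(_ h);
      by rewrite smorphZ// bopZ rinZl pmulr_rge0.
  have [y [ys y1 yy zy]] := selfadjoint_abs zs z1.
  (* Both [phi1 (1 - y)] and [phi1 z] are positive square roots of [phi1 (z * z)]. *)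
  have : phi1 (1 - y - z) = 0.
    rewrite smorphB//; apply/eqP; rewrite subr_eq0; apply/eqP.
    apply: psd_sqr_inj; rewrite -?(smorph_star m1) -?(smorphM m1).
    - by rewrite starB star1 ys.
    - by rewrite zs.
    - exact: smorph_one_minus_psd.
    - exact/psdz.
    - by rewrite mulrBl mulrBr mul1r mulr1 zy.
    - by rewrite yy.
  move/ker; rewrite smorphB// => /subr0_eq yz.
  by apply/(psdz _ _ m2); rewrite -yz; exact: smorph_one_minus_psd.
move=> a; apply/ler_addgt0Pr => e e0.
(* Adding [e] allows the normalization of [a] even when [phi1 a = 0]. *)
have d0 : 0 < nrm (phi1 a) + e by rewrite ltr_wpDl ?nrm_ge0.
have := le1 ((nrm (phi1 a) + e)^-1%:C *: a).
rewrite !smorphZ// !nrmZ_ge0 ?invr_ge0 ?(ltW d0)// ![_^-1 * _]mulrC.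
by rewrite !ler_pdivrMr// !mul1r lerDl => /(_ (ltW e0)).
Qed.

(** * Representations and their degree-0 part *)

Section ComplementaryProjection.
Variables (R : realType) (B : cstarAlgType R) (Q : B).
Hypotheses (Qs : star Q = Q) (QQ : Q * Q = Q).

Lemma star_compl_proj : star (1 - Q) = 1 - Q.
Proof. by rewrite starB star1 Qs. Qed.

Lemma compl_proj_idem : (1 - Q) * (1 - Q) = 1 - Q.
Proof. by rewrite mulrBl !mulrBr !mulr1 !mul1r QQ subrr subr0. Qed.

Lemma nrm_mul_proj_le (x : B) : nrm (x * Q) <= nrm x.
Proof. by rewrite (le_trans (nrmM _ _))// ler_piMr ?nrm_ge0// nrm_proj_le1. Qed.

End ComplementaryProjection.

Section BlockDiagonal.
Variables (R : realType) (H : hilbertType R).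
Let B : cstarAlgType R := 'L(H).
Variable Q : B.
Hypotheses (Qs : star Q = Q) (QQ : Q * Q = Q).

Lemma nrm_proj_split (h : H) :
  nrm h ^+ 2 = nrm ((1 - Q : B) h) ^+ 2 + nrm ((Q : B) h) ^+ 2.
Proof.
have Qcs := star_compl_proj Qs; have QcQ := compl_proj_idem QQ.
have := rin_starM Q h; have := rin_starM (1 - Q) h.
rewrite [star (1 - _)]Qcs [star Q]Qs [(1 - Q) * _]QcQ [Q * _]QQ => <- <-.
by rewrite -rinDl bopB subrK rinxx.
Qed.

(** As [T] commutes with [Q], it acts separately on the two orthogonal summands, and the bounds add
    up by Pythagoras. *)
Lemma nrm_block_le (T : B) (c : R) : T * Q = Q * T -> 0 <= c ->
  nrm (T * (1 - Q)) <= c -> nrm (T * Q) <= c -> nrm T <= c.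
Proof.
move=> TQ c0 cQc cQ; apply: opnorm_le => // h.
rewrite -(@ler_pXn2r _ 2)// ?nnegrE ?mulr_ge0 ?nrm_ge0// exprMn.
rewrite (nrm_proj_split h) mulrDr (nrm_proj_split (bop_fun T h)).
have le (P : B) : T * P = P * T -> P * P = P -> nrm (T * P) <= c ->
    nrm (bop_fun P (bop_fun T h)) ^+ 2 <= c ^+ 2 * nrm (bop_fun P h) ^+ 2.
  move=> TP PP cP; rewrite -exprMn ler_pXn2r ?nnegrE ?mulr_ge0 ?nrm_ge0//.
  have -> : bop_fun P (bop_fun T h) = bop_fun (T * P) (bop_fun P h).
    by rewrite -[LHS]/(bop_fun (P * T) h) -TP -{1}PP mulrA.
  by rewrite (le_trans (le_opnorm _ _))// ler_wpM2r ?nrm_ge0.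
apply: lerD; apply: le => //; last exact: compl_proj_idem.
by rewrite mulrBl mulrBr mulr1 mul1r TQ.
Qed.

End BlockDiagonal.

(* The target is an arbitrary C*-algebra because ['L(H)] carries two ring
   structures, convertible but syntactically different, and rewriting does not
   identify them. *)
Record cstar_representation (R : realType) (A B : cstarAlgType R)
    (alpha : A -> A) (pi : A -> B) (U : B) : Prop := CStarRepresentation {
  crep_morphism : star_morphism pi;
  crep_unital : pi 1 = 1;
  crep_endo : forall a, U * pi a * star U = pi (alpha a)
}.

Lemma representation_cstar (R : realType) (A : cstarAlgType R)
    (alpha : A -> A) (H : hilbertType R) (pi : A -> 'L(H)) (U : 'L(H)) :
  representation alpha pi U ->
  @cstar_representation R A 'L(H) alpha pi U.
Proof. by case=> m u e; split. Qed.

Section Representation.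
Variables (R : realType) (A B : cstarAlgType R) (alpha : A -> A).
Hypothesis alphaP : star_morphism alpha.
Variables (pi : A -> B) (U : B).
Hypothesis rep : cstar_representation alpha pi U.

Let piP : star_morphism pi := crep_morphism rep.
Let Q : B := star U * U.

Let piM a b : pi (a * b) = pi a * pi b. Proof. exact: smorphM piP a b. Qed.
Let piD a b : pi (a + b) = pi a + pi b. Proof. exact: smorphD piP a b. Qed.
Let piS a : pi (star a) = star (pi a). Proof. exact: smorph_star piP a. Qed.
Let pi1 : pi 1 = 1. Proof. exact: (crep_unital rep). Qed.
Let alM a b : alpha (a * b) = alpha a * alpha b.
Proof. exact: smorphM alphaP a b. Qed.
Let alS a : alpha (star a) = star (alpha a).
Proof. exact: smorph_star alphaP a. Qed.

Lemma rep_UUstar : U * star U = pi (alpha 1).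
Proof. by rewrite -(crep_endo rep) pi1 mulr1. Qed.

(* The difference [w] of the two sides satisfies [w w^* = 0]. *)
Lemma rep_intertwine a : U * pi a = pi (alpha a) * U.
Proof.
apply/subr0_eq; rewrite -[LHS]starK -[RHS]starK; congr star.
rewrite star0; apply: starM_eq0; rewrite starK starB !starMr.
rewrite -!piS -!alS mulrBl !mulrBr.
have e b c : U * pi b * (pi c * star U) = pi (alpha b * alpha c).
  by rewrite mulrA -[_ * pi c]mulrA -piM (crep_endo rep) alM.
rewrite e [_ * (star U * _)]mulrA (crep_endo rep).
rewrite -[pi (alpha a) * U * (pi _ * _)]mulrA [U * (pi _ * _)]mulrA.
rewrite (crep_endo rep) -[pi (alpha a) * U * _]mulrA [U * (star U * _)]mulrA.
rewrite rep_UUstar.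
by rewrite -!piM -!alM mul1r !subrr.
Qed.

Lemma rep_intertwine_star a : pi a * star U = star U * pi (alpha a).
Proof.
have := congr1 star (rep_intertwine (star a)).
by rewrite !starMr -!piS -alS starK.
Qed.

Lemma repX_intertwine n a : U ^+ n * pi a = pi (iter n alpha a) * U ^+ n.
Proof.
elim: n a => [|n IH] a; first by rewrite expr0 mul1r mulr1.
by rewrite exprS -mulrA IH mulrA rep_intertwine -mulrA.
Qed.

Lemma repX_intertwine_star n a :
  pi a * star U ^+ n = star U ^+ n * pi (iter n alpha a).
Proof.
elim: n a => [|n IH] a; first by rewrite expr0 mul1r mulr1.
by rewrite exprSr mulrA IH -mulrA rep_intertwine_star mulrA.
Qed.

Lemma repX_UUstar n : U ^+ n * star U ^+ n = pi (iter n alpha 1).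
Proof.
elim: n => [|n IH]; first by rewrite expr0 mulr1 pi1.
rewrite exprS exprSr mulrA -[_ * U ^+ n * _]mulrA IH.
by rewrite (crep_endo rep).
Qed.

Lemma rep_pi1U : pi (alpha 1) * U = U.
Proof. by rewrite -rep_intertwine pi1 mulr1. Qed.

Lemma rep_Ustar_pi1 : star U * pi (alpha 1) = star U.
Proof. by rewrite -rep_intertwine_star pi1 mul1r. Qed.

(** Compressing a coefficient to the corner required in [property_star] does not change the
    operator, because [pi 1] can be moved past the powers of [star U] and [U]. *)
Lemma repX_corner m n a : star U ^+ m * pi a * U ^+ n =
  star U ^+ m * pi (iter m alpha 1 * a * iter n alpha 1) * U ^+ n.
Proof.
rewrite !piM !mulrA -repX_intertwine_star pi1 mul1r.
by rewrite -[RHS]mulrA -repX_intertwine pi1 mulr1.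
Qed.

(** [U] is a partial isometry: [U * star U] is the projection [pi (alpha 1)]. *)
Lemma rep_nrmU : nrm U <= 1.
Proof.
rewrite -(@ler_pXn2r _ 2)// ?nnegrE ?nrm_ge0// expr1n -nrm_Mstar rep_UUstar.
apply: nrm_proj_le1; rewrite -?piS -?piM -?alS -?alM ?star1 ?mulr1//.
Qed.

Lemma rep_Q_star : star Q = Q.
Proof. by rewrite starMr starK. Qed.

Lemma rep_Q_idem : Q * Q = Q.
Proof. by rewrite /Q mulrA -[star U * U * _]mulrA rep_UUstar rep_Ustar_pi1. Qed.

Lemma rep_Q_comm a : pi a * Q = Q * pi a.
Proof.
by rewrite /Q mulrA rep_intertwine_star -!mulrA rep_intertwine.
Qed.

(** Multiplicativity holds because the projection [1 - Q] commutes with the range of [pi]. Under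
    covariance the kernel of this morphism is [J]. *)
Lemma rep_compl_morphism : star_morphism (fun a => pi a * (1 - Q)).
Proof.
have cQ a : pi a * (1 - Q) = (1 - Q) * pi a.
  by rewrite mulrBl mulrBr mul1r mulr1 rep_Q_comm.
split=> [k x y|x y|x]; first by rewrite (smorph_scaleD piP) mulrDl scaleM_l.
  rewrite piM [RHS]mulrA -[X in _ = X * _]mulrA -cQ mulrA -[RHS]mulrA.
  by rewrite (compl_proj_idem rep_Q_idem).
by rewrite piS starMr (star_compl_proj rep_Q_star) -piS cQ.
Qed.

Definition core_sum N (a : nat -> A) : B :=
  \sum_(m < N.+1) star U ^+ m * pi (a m) * U ^+ m.

(** Coefficients of [U * core_sum N.+1 a * star U]. Conjugation by [U] merges the terms of index 0
    and 1, which shortens the sum by one; moving [pi (alpha 1)] past the outer powers compresses the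
    later coefficients. *)
Definition core_shift (a : nat -> A) (m : nat) : A :=
  if m is 0 then alpha (a 0%N) + alpha 1 * a 1%N * alpha 1
  else iter m.+1 alpha 1 * a m.+1 * iter m.+1 alpha 1.

Lemma core_sumS N a : core_sum N.+1 a =
  pi (a 0%N) + star U * core_sum N (fun m => a m.+1) * U.
Proof.
rewrite /core_sum big_ord_recl !expr0 mul1r mulr1; congr (_ + _).
rewrite mulr_sumr mulr_suml; apply: eq_bigr => i _.
by rewrite lift0 exprS exprSr !mulrA.
Qed.

Lemma core_sum_shift N a : core_sum N (core_shift a) =
  pi (alpha (a 0%N)) +
  pi (alpha 1) * core_sum N (fun m => a m.+1) * pi (alpha 1).
Proof.
rewrite /core_sum mulr_sumr mulr_suml !big_ord_recl addrA; congr (_ + _).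
  by rewrite !expr0 !mul1r !mulr1 piD !piM.
apply: eq_bigr => i _; rewrite lift0 !mulrA repX_intertwine_star.
rewrite -[RHS]mulrA repX_intertwine mulrA -[_ * pi (a _)]mulrA -piM.
by rewrite -[_ * _ * pi _]mulrA -piM -!iterSr.
Qed.

(** [U] annihilates [1 - Q], and every term of positive index ends in [U]. *)
Lemma core_sum_compl N a :
  core_sum N.+1 a * (1 - Q) = pi (a 0%N) * (1 - Q).
Proof.
have UQ : U * (1 - Q) = 0.
  by rewrite mulrBr mulr1 /Q mulrA rep_UUstar rep_pi1U subrr.
by rewrite core_sumS mulrDl -[X in _ + X]mulrA UQ mulr0 addr0.
Qed.

(** In [pi (a 0) * Q], moving the coefficient past [star U] makes the term of index 0 a conjugate by
    [U] as well, so that it is absorbed into the shorter sum. *)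
Lemma core_sum_proj N a :
  core_sum N.+1 a * Q = star U * core_sum N (core_shift a) * U.
Proof.
rewrite core_sumS core_sum_shift mulrDl mulrDr mulrDl; congr (_ + _).
  by rewrite -rep_intertwine_star -mulrA.
rewrite !mulrA rep_Ustar_pi1 -[RHS]mulrA rep_pi1U.
by rewrite -2![LHS]mulrA [U * _]mulrA rep_UUstar rep_pi1U.
Qed.

Lemma core_sum_comm N a : core_sum N.+1 a * Q = Q * core_sum N.+1 a.
Proof.
rewrite core_sumS mulrDl mulrDr rep_Q_comm; congr (_ + _).
rewrite /Q !mulrA -[star U * U * star U]mulrA rep_UUstar rep_Ustar_pi1.
by rewrite -2![LHS]mulrA [U * _]mulrA rep_UUstar rep_pi1U.
Qed.

(** The shifted sum lies in the corner of the projection [U * star U], so conjugating back by [U]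
    recovers it; neither conjugation raises the norm. *)
Lemma nrm_core_shift N a :
  nrm (star U * core_sum N (core_shift a) * U) =
  nrm (core_sum N (core_shift a)).
Proof.
set Y := core_sum _ _.
have Usn : nrm (star U) <= 1 by rewrite nrm_star rep_nrmU.
have contr (S T V : B) : nrm S <= 1 -> nrm V <= 1 -> nrm (S * T * V) <= nrm T.
  move=> S1 V1; rewrite (le_trans (nrmM _ _))// (@le_trans _ _ (nrm (S * T)))//.
    by rewrite ler_piMr ?nrm_ge0.
  by rewrite (le_trans (nrmM _ _))// ler_piMl ?nrm_ge0.
apply/eqP; rewrite eq_le contr ?rep_nrmU//=.
have pp : alpha 1 * alpha 1 = alpha 1 by rewrite -alM mulr1.
have YE : U * (star U * Y * U) * star U = Y.
  rewrite !mulrA rep_UUstar -mulrA rep_UUstar /Y core_sum_shift.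
  rewrite mulrDr mulrDl -!piM -!alM mulr1 mul1r; congr (_ + _).
  by rewrite !mulrA -piM pp -!mulrA -piM pp.
by rewrite -{1}YE contr ?rep_nrmU.
Qed.

End Representation.

(** Induction on [N]. For [N = 0] the kernel of [pi1] is trivial. In the inductive step the
    compression by [1 - Q] is governed by the morphisms with kernel [J], and the compression by [Q]
    by a sum that is one term shorter. *)
Lemma core_sum_nrm_le (R : realType) (A : cstarAlgType R) (alpha : A -> A)
    (J : set A) (H1 H2 : hilbertType R) (pi1 : A -> 'L(H1)) (U1 : 'L(H1))
    (pi2 : A -> 'L(H2)) (U2 : 'L(H2)) :
  star_morphism alpha ->
  faithful_representation alpha pi1 U1 -> covariant pi1 U1 J ->
  representation alpha pi2 U2 -> covariant pi2 U2 J ->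
  forall N a, nrm (core_sum pi2 U2 N a) <= nrm (core_sum pi1 U1 N a).
Proof.
move=> alphaP [/representation_cstar rep1 inj1] cov1.
move=> /representation_cstar rep2 cov2.
have m1 := crep_morphism rep1; have m2 := crep_morphism rep2.
have kerJ (H : hilbertType R) (pi : A -> 'L(H)) (U : 'L(H)) :
    @cstar_representation R A 'L(H) alpha pi U ->
    covariant pi U J -> forall a, pi a * (1 - star U * U) = 0 <-> J a.
  move=> rep -> a /=; have := rep_Q_comm alphaP rep a.
  rewrite mulrBr mulr1 => ->.
  by split=> [/subr0_eq|/= ->]; rewrite ?subrr.
elim=> [|N IH] a.
  rewrite /core_sum !big_ord1 !expr0 !mul1r !mulr1.
  apply: (smorph_kernel_nrm_le m1 m2) => b b0.
  have -> : b = 0 by apply: inj1; rewrite b0 (smorph0 m1).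
  by rewrite (smorph0 m2).
have Q1s := rep_Q_star (U1 : ('L(H1) : cstarAlgType R)).
have Q1i := rep_Q_idem alphaP rep1.
have Q2s := rep_Q_star (U2 : ('L(H2) : cstarAlgType R)).
apply: (nrm_block_le Q2s (rep_Q_idem alphaP rep2)
  (core_sum_comm alphaP rep2 N a)).
- exact: nrm_ge0.
- rewrite (core_sum_compl alphaP rep2).
  apply: le_trans
    (nrm_mul_proj_le (star_compl_proj Q1s) (compl_proj_idem Q1i) _).
  rewrite (core_sum_compl alphaP rep1 N).
  apply: (smorph_kernel_nrm_le (rep_compl_morphism alphaP rep1)
    (rep_compl_morphism alphaP rep2)) => b.
  by move/(kerJ _ _ _ rep1 cov1)/(kerJ _ _ _ rep2 cov2).
- rewrite (core_sum_proj alphaP rep2) (nrm_core_shift alphaP rep2).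
  apply: (le_trans (IH _)); rewrite -(nrm_core_shift alphaP rep1).
  by rewrite -(core_sum_proj alphaP rep1) nrm_mul_proj_le.
Qed.

(** * Words and the norm estimate *)

Section RealInequalities.
Variable R : realType.

Lemma sqr_sum_le K (c : 'I_K -> R) :
  (\sum_i c i) ^+ 2 <= K%:R * \sum_i c i ^+ 2.
Proof.
elim: K c => [|K IH] c; first by rewrite !big_ord0 expr0n mulr0.
rewrite !big_ord_recl -natr1.
have := IH (fun i => c (lift ord0 i)).
set S := \sum_(i < K) _; set T := \sum_(i < K) _; set k : R := K%:R => ST.
have T0 : 0 <= T by apply: sumr_ge0 => i _; exact: sqr_ge0.
have [k0|k0] := eqVneq k 0.
  have S0 : S = 0.
    by apply/eqP; rewrite -sqrf_eq0 eq_le sqr_ge0 (le_trans ST)// k0 mul0r.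
  by rewrite S0 k0 addr0 add0r mul1r lerDl.
have kp : 0 < k by rewrite lt_def k0 ler0n.
(* With [S ^+ 2 <= k * T], this product dominates the square of [k * c ord0 - S]. *)
have : 0 <= k * (k * c ord0 ^+ 2 + T - 2 * c ord0 * S).
  by have := sqr_ge0 (k * c ord0 - S); nra.
by rewrite pmulr_rge0//; nra.
Qed.

Lemma bernoulli_le (d : R) n : 0 <= d -> 1 + n%:R * d <= (1 + d) ^+ n.
Proof.
move=> d0; elim: n => [|n IH]; first by rewrite mul0r addr0 expr0.
rewrite exprS -natr1.
have h : (1 + d) * (1 + n%:R * d) <= (1 + d) * (1 + d) ^+ n.
  by rewrite ler_wpM2l// addr_ge0.
apply: le_trans h; have : 0 <= n%:R * d * d by rewrite !mulr_ge0.
nra.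
Qed.

(** If [x] exceeded [y + e], the powers of [x / (y + e)] would outgrow the factor, which is only
    linear in the exponent. *)
Lemma le_of_exp_le (x y : R) (C : nat) : 0 <= y ->
  (forall k, x ^+ (2 ^ k.+2) <= ((2 ^ k.+2 * C).+1)%:R * y ^+ (2 ^ k.+2)) ->
  x <= y.
Proof.
move=> y0 H; apply/ler_addgt0Pr => e e0.
set z := y + e; have z0 : 0 < z by rewrite ltr_wpDl.
rewrite leNgt; apply/negP => zx.
pose d := x / z - 1; have d0 : 0 < d by rewrite subr_gt0 ltr_pdivlMr// mul1r.
(* With [j] half the exponent and [k <= j], this choice gives [2 * C + 1 <= j * d ^+ 2]. Hence the
   square of [j * d] is at least [j * (2 * C + 1)], which is at least [2 * j * C + 1] as [j] is
   positive. *)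
have [k kC] : exists k : nat, (2 * C + 1)%:R / d ^+ 2 < k%:R.
  exists (Num.bound ((2 * C + 1)%:R / d ^+ 2)).
  by apply: archi_boundP; rewrite divr_ge0// sqr_ge0.
pose j := (2 ^ k.+1)%N.
have kj : (k <= j)%N.
  by rewrite /j (leq_trans (ltnW (ltnSn k)))// ltnW// ltn_expl.
have j1 : (1 <= j)%N by rewrite expn_gt0.
have : (x / z) ^+ (2 ^ k.+2) <= (2 ^ k.+2 * C).+1%:R.
  rewrite expr_div_n ler_pdivrMr ?exprn_gt0// (le_trans (H k))//.
  rewrite ler_wpM2l// lerXn2r ?nnegrE ?(ltW z0)// /z lerDl ltW//.
have -> : x / z = 1 + d by rewrite addrC subrK.
(* Bernoulli is applied to half the exponent and then squared, which yields quadratic growth. *)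
rewrite expnSr exprM -/j leNgt => /negP; apply.
have h := bernoulli_le j (ltW d0).
have h2 : (j%:R * d) ^+ 2 < ((1 + d) ^+ j) ^+ 2.
  have jd : 0 <= j%:R * d by rewrite mulr_ge0// ltW.
  rewrite ltr_pXn2r ?nnegrE//; first by rewrite (lt_le_trans _ h)// ltrDr.
  by rewrite (le_trans _ h)// addr_ge0.
apply: le_lt_trans h2; rewrite exprMn.
rewrite ltr_pdivrMr ?exprn_gt0// in kC.
have h3 : (2 * C + 1)%:R <= j%:R * d ^+ 2.
  by rewrite (le_trans (ltW kC))// ler_wpM2r ?sqr_ge0// ler_nat.
rewrite (expr2 j%:R) -mulrA (@le_trans _ _ (j%:R * (2 * C + 1)%:R))//.
  rewrite -natrM ler_nat; nia.
by rewrite ler_wpM2l.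
Qed.

End RealInequalities.

(** Cauchy-Schwarz at each vector [h], where the squared norms of the [X i h] add up to the form of
    [S]. *)
Lemma nrm_sum_sqr_le (R : realType) (H : hilbertType R) K
    (X : 'I_K -> 'L(H) : cstarAlgType R) :
  nrm (\sum_i X i) ^+ 2 <= K%:R * nrm (\sum_i star (X i) * X i).
Proof.
set S := \sum_i _ * _.
have KS0 : 0 <= K%:R * nrm S by rewrite mulr_ge0// nrm_ge0.
rewrite -(sqr_sqrtr KS0) ler_pXn2r ?nnegrE ?nrm_ge0 ?sqrtr_ge0//.
apply: opnorm_le => [|h]; first exact: sqrtr_ge0.
rewrite -(@ler_pXn2r _ 2)// ?nnegrE ?mulr_ge0 ?nrm_ge0 ?sqrtr_ge0//.
rewrite exprMn sqr_sqrtr//.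
have app (I : Type) (r : seq I) (F : I -> 'L(H)) :
    (\sum_(i <- r) F i) h = \sum_(i <- r) F i h.
  by elim/big_rec2: _ => // i u v _ <-.
have h1 : \sum_i nrm (bop_fun (X i) h) ^+ 2 <= nrm S * nrm h ^+ 2.
  have -> : \sum_i nrm (bop_fun (X i) h) ^+ 2 = rin (bop_fun S h) h.
    rewrite [bop_fun S h]app; elim/big_rec2: _ => [|i u v _ ->].
      by rewrite /rin inner0l.
    by rewrite rinDl -rin_starM.
  rewrite (le_trans (rin_le _ _))// expr2 mulrA ler_wpM2r ?nrm_ge0//.
  exact: le_opnorm.
apply: (@le_trans _ _ ((\sum_i nrm (bop_fun (X i) h)) ^+ 2)).
  rewrite lerXn2r ?nnegrE ?nrm_ge0 ?sumr_ge0// => [i _|]; first exact: nrm_ge0.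
  by rewrite [bop_fun _ h]app nrm_sum.
by rewrite (le_trans (sqr_sum_le _))// -mulrA ler_wpM2l.
Qed.

(** Links sums over words, which are lists, with the finitely supported sums of [property_star]; the
    keys of the list contain the support. *)
Lemma fsbig_fiber (V : nmodType) (I : eqType) (K : choiceType) (s : seq I)
    (key : I -> K) (F : I -> V) :
  \sum_(p \in [set: K]) \sum_(x <- s | key x == p) F x = \sum_(x <- s) F x.
Proof.
rewrite (fsbigE (undup (map key s))) ?undup_uniq//; last first.
  move=> p _; rewrite mem_undup => ps; rewrite big_seq_cond big1// => x.
  by case/andP=> xs /eqP xp; case/negP: ps; rewrite -xp map_f.
under eq_bigl do rewrite in_setT.
under eq_bigr do rewrite big_mkcond.
rewrite exchange_big /=; apply: eq_big_seq => x xs.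
rewrite (bigD1_seq (key x)) ?undup_uniq ?mem_undup ?map_f//= eqxx.
by rewrite big1 ?addr0// => p; rewrite eq_sym => /negbTE->.
Qed.

Section Words.
Variables (R : realType) (A : cstarAlgType R) (alpha : A -> A).

(* [(m, a, n)] stands for [U^*m pi(a) U^n]. *)
Definition monomial := (nat * A * nat)%type.

Definition word_bounded M (s : seq monomial) :=
  all (fun x => (x.1.1 <= M) && (x.2 <= M))%N s.

Definition monomial_star (x : monomial) : monomial := (x.2, star x.1.2, x.1.1).

(** Between the two coefficients stands [U^n U^*k]. Its common power [j], the minimum of [n] and
    [k], becomes [pi(alpha^j(1))], and what is left of [U] or [U^*] moves outwards past that
    projection and the next coefficient, applying [alpha] to both. *)
Definition monomial_mul (x y : monomial) : monomial :=
  if (y.1.1 <= x.2)%N then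
    (x.1.1, x.1.2 * iter x.2 alpha 1 * iter (x.2 - y.1.1) alpha y.1.2,
     (x.2 - y.1.1 + y.2)%N)
  else
    ((x.1.1 + (y.1.1 - x.2))%N,
     iter (y.1.1 - x.2) alpha x.1.2 * iter y.1.1 alpha 1 * y.1.2, y.2).

Definition word_star (s : seq monomial) := map monomial_star s.

Definition word_mul (s t : seq monomial) :=
  [seq monomial_mul x y | x <- s, y <- t].

Definition word_diag (s : seq monomial) := [seq x <- s | x.1.1 == x.2].

Lemma word_bounded_star M s : word_bounded M s -> word_bounded M (word_star s).
Proof.
by rewrite /word_bounded all_map; apply: sub_all => x /=; rewrite andbC.
Qed.

Lemma word_bounded_mul M N s t :
  word_bounded M s -> word_bounded N t -> word_bounded (M + N) (word_mul s t).
Proof.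
move=> /allP sM /allP tN; apply/allP => _ /allpairsP[[x y] /= [xs yt ->]].
have := sM _ xs; have := tN _ yt; rewrite /monomial_mul.
by case: (leqP y.1.1 x.2) => /= ? /andP[? ?] /andP[? ?]; lia.
Qed.

Lemma word_boundedP s : exists M, word_bounded M s.
Proof.
elim: s => [|x s [M sM]]; first by exists 0%N.
exists (maxn (maxn x.1.1 x.2) M); rewrite /= !leq_max !leqnn orbT /=.
by apply: sub_all sM => y /andP[? ?]; rewrite !leq_max; lia.
Qed.

(** The right-hand side compares the degrees [n - m] of [x] and [y] without truncated subtraction:
    only pairs of equal degree contribute to the degree-0 part of a product [x^* y]. *)
Lemma word_diag_starM x y :
  ((monomial_mul (monomial_star x) y).1.1 ==
   (monomial_mul (monomial_star x) y).2) =
  (x.2 + y.1.1 == x.1.1 + y.2)%N.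
Proof. by rewrite /monomial_mul /=; case: leqP => /= ?; lia. Qed.

Hypothesis alphaP : star_morphism alpha.
Variables (B : cstarAlgType R) (pi : A -> B) (U : B).
Hypothesis rep : cstar_representation alpha pi U.

Let piP : star_morphism pi := crep_morphism rep.

Definition meval (x : monomial) : B := star U ^+ x.1.1 * pi x.1.2 * U ^+ x.2.

Definition weval (s : seq monomial) : B := \sum_(x <- s) meval x.

Lemma meval_star x : meval (monomial_star x) = star (meval x).
Proof. by rewrite /meval /= !starMr !starX starK (smorph_star piP) mulrA. Qed.

Lemma meval_mul x y : meval (monomial_mul x y) = meval x * meval y.
Proof.
case: x y => [[m a] n] [[k b] l]; rewrite /monomial_mul /meval /=.
have UU := repX_UUstar rep; have Upi := repX_intertwine alphaP rep.
have piU := repX_intertwine_star alphaP rep.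
case: leqP => /= [kn|/ltnW nk].
  have -> : star U ^+ m * pi a * U ^+ n * (star U ^+ k * pi b * U ^+ l) =
      star U ^+ m * (pi a * (U ^+ (n - k) * (U ^+ k * star U ^+ k) * pi b))
        * U ^+ l.
    by rewrite -{1}(subnK kn) exprD !mulrA.
  rewrite UU Upi -iterD subnK// -[_ * U ^+ (n - k) * _]mulrA Upi !mulrA.
  by rewrite !(smorphM piP) exprD !mulrA.
have -> : star U ^+ m * pi a * U ^+ n * (star U ^+ k * pi b * U ^+ l) =
    star U ^+ m * (pi a * ((U ^+ n * star U ^+ n) * star U ^+ (k - n)) * pi b)
      * U ^+ l.
  by rewrite -{1}(subnKC nk) exprD !mulrA.
rewrite UU piU -iterD subnK// [pi a * _]mulrA piU !mulrA.
by rewrite !(smorphM piP) exprD !mulrA.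
Qed.

Lemma weval_star s : weval (word_star s) = star (weval s).
Proof.
by rewrite /weval big_map star_sum; apply: eq_bigr => x _; rewrite meval_star.
Qed.

Lemma weval_mul s t : weval (word_mul s t) = weval s * weval t.
Proof.
rewrite /weval big_allpairs_dep mulr_suml; apply: eq_bigr => x _.
by rewrite mulr_sumr; apply: eq_bigr => y _; rewrite meval_mul.
Qed.

Lemma weval_cat s t : weval (s ++ t) = weval s + weval t.
Proof. exact: big_cat. Qed.

Lemma weval_scale k s :
  weval [seq (x.1.1, k *: x.1.2, x.2) | x <- s] = k *: weval s.
Proof.
rewrite /weval big_map scaler_sumr; apply: eq_bigr => x _.
by rewrite /meval /= (smorphZ piP) scaleM_r scaleM_l.
Qed.

Lemma weval_diag M s : word_bounded M s -> weval (word_diag s) =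
  core_sum pi U M (fun m => \sum_(x <- word_diag s | x.1.1 == m) x.1.2).
Proof.
move=> sM; rewrite /weval /core_sum.
have dM x : x \in word_diag s -> (x.1.1 <= M)%N /\ x.1.1 = x.2.
  by rewrite mem_filter => /andP[/eqP xx /(allP sM)/andP[]].
rewrite (partition_big (fun x : monomial => inord x.1.1 : 'I_M.+1) xpredT)//.
apply: eq_bigr => i _; rewrite (smorph_sum piP) mulr_sumr mulr_suml.
rewrite [LHS]big_seq_cond [RHS]big_seq_cond; apply: eq_big => [x|x].
  by case: (boolP (x \in _)) => //= /dM[xM _]; rewrite -val_eqE /= inordK.
case/andP=> /dM[xM xx] /=; rewrite -val_eqE /= inordK// => /eqP xi.
by rewrite /meval -xx xi.
Qed.

(* The components [X i] are the parts of [s] of a given degree [n - m], shifted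
   by [M] so as to be nonnegative. *)
Lemma weval_grading M s : word_bounded M s ->
  exists X : 'I_(M + M).+1 -> B, weval s = \sum_i X i /\
    weval (word_diag (word_mul (word_star s) s)) = \sum_i star (X i) * X i.
Proof.
move=> /allP sM.
(* On letters of [s] neither the subtraction nor [inord] truncates, as both exponents are at most
   [M]. *)
pose c (x : monomial) : 'I_(M + M).+1 := inord (x.2 + M - x.1.1).
pose X i := \sum_(x <- s | c x == i) meval x.
exists X; split; first exact: (partition_big c xpredT).
have -> : \sum_i star (X i) * X i = \sum_(x <- s) star (meval x) * X (c x).
  rewrite [RHS](partition_big c xpredT)//; apply: eq_bigr => i _.
  by rewrite {1}/X star_sum mulr_suml; apply: eq_bigr => x /eqP->.
rewrite /weval big_filter big_mkcond big_allpairs_dep big_map.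
apply: eq_big_seq => x xs; rewrite -big_mkcond /= mulr_sumr.
rewrite [LHS]big_seq_cond [RHS]big_seq_cond.
apply: eq_big => [y|y _]; last first.
  by rewrite meval_mul meval_star.
case: (boolP (y \in s)) => //= ys; rewrite word_diag_starM -val_eqE /=.
have /andP[? ?] := sM _ xs; have /andP[? ?] := sM _ ys.
by rewrite !inordK; lia.
Qed.

(** Repeated squaring of [x^* x]: for these powers the C*-identity gives the norm exactly. *)
Fixpoint word_power (s : seq monomial) k : seq monomial :=
  if k is k'.+1 then word_mul (word_power s k') (word_power s k')
  else word_mul (word_star s) s.

Lemma word_bounded_power M s k :
  word_bounded M s -> word_bounded (2 ^ k.+1 * M) (word_power s k).
Proof.
move=> sM; elim: k => [|k IH] /=.
  by rewrite mul2n -addnn word_bounded_mul ?word_bounded_star.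
by rewrite expnS -mulnA mul2n -addnn word_bounded_mul.
Qed.

Lemma weval_power s k :
  weval (word_power s k) = (star (weval s) * weval s) ^+ (2 ^ k).
Proof.
elim: k => [|k IH] /=; first by rewrite weval_mul weval_star.
by rewrite weval_mul IH -exprD addnn -mul2n -expnS.
Qed.

Lemma nrm_weval_power s k :
  nrm (weval (word_power s k)) = nrm (weval s) ^+ (2 ^ k.+1).
Proof.
rewrite weval_power nrm_selfadjX2 ?starMr ?starK// nrm_starM.
by rewrite -exprM -expnS.
Qed.

End Words.

(** A word may repeat a pair of exponents and have coefficients outside the corners. Its letters are
    therefore collected by exponents and compressed, which leaves both sums unchanged, before
    [property_star] applies. *)
Lemma weval_diag_le (R : realType) (A : cstarAlgType R) (alpha : A -> A)
    (H : hilbertType R) (pi : A -> 'L(H)) (U : 'L(H)) :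
  star_morphism alpha -> representation alpha pi U ->
  property_star alpha pi U ->
  forall s : seq (monomial A),
    nrm (weval pi U (word_diag s)) <= nrm (weval pi U s).
Proof.
move=> alphaP /representation_cstar rep Ustar s.
have piP := crep_morphism rep.
pose key (x : monomial A) := (x.1.1, x.2).
pose b (p : nat * nat) : A := \sum_(x <- s | key x == p) x.1.2.
pose a (m n : nat) : A := iter m alpha 1 * b (m, n) * iter n alpha 1.
have aE m n : star U ^+ m * pi (a m n) * U ^+ n =
    \sum_(x <- s | key x == (m, n)) meval pi U x.
  have /esym -> := repX_corner alphaP rep m n (b (m, n)).
  rewrite (smorph_sum piP) mulr_sumr mulr_suml; apply: eq_bigr => x /eqP[<- <-].
  by [].
have fin : finite_set [set p : nat * nat | a p.1 p.2 != 0].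
  apply: (@sub_finite_set _ _ [set` map key s]); last exact: finite_seq.
  move=> [m n] /=; apply: contraNT => ps; rewrite /a /b big_seq_cond.
  rewrite big1 ?mulr0 ?mul0r// => x /andP[xs /eqP xp].
  by case/negP: ps; rewrite -xp map_f.
have diagE : weval pi U (word_diag s) =
    \sum_(m \in [set: nat]) star U ^+ m * pi (a m m) * U ^+ m.
  rewrite /weval -(fsbig_fiber _ (fun x : monomial A => x.1.1)).
  apply: eq_fsbigr => m _; rewrite [RHS]aE big_filter_cond; apply: eq_bigl => x.
  by rewrite /key -pair_eqE /=; lia.
have allE : weval pi U s =
    \sum_(p \in [set: nat * nat]) star U ^+ p.1 * pi (a p.1 p.2) * U ^+ p.2.
  rewrite /weval -(fsbig_fiber _ key); apply: eq_fsbigr => -[m n] _.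
  by rewrite [RHS]aE.
rewrite diagE allE -lecR !nrmE.
exact: Ustar a fin (fun m n => ex_intro _ (b (m, n)) erefl).
Qed.

Lemma weval_diag_nrm_le (R : realType) (A : cstarAlgType R) (alpha : A -> A)
    (J : set A) (H1 H2 : hilbertType R) (pi1 : A -> 'L(H1)) (U1 : 'L(H1))
    (pi2 : A -> 'L(H2)) (U2 : 'L(H2)) :
  star_morphism alpha ->
  faithful_representation alpha pi1 U1 -> covariant pi1 U1 J ->
  representation alpha pi2 U2 -> covariant pi2 U2 J ->
  forall s : seq (monomial A),
    nrm (weval pi2 U2 (word_diag s)) <= nrm (weval pi1 U1 (word_diag s)).
Proof.
move=> alphaP fr1 cov1 rep2 cov2 s; have [M sM] := word_boundedP s.
rewrite (weval_diag (representation_cstar rep2) sM).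
rewrite (weval_diag (representation_cstar fr1.1) sM).
exact: (core_sum_nrm_le alphaP fr1 cov1 rep2 cov2).
Qed.

(* The degree-0 part controls a word up to a factor linear in its exponents,
   which becomes harmless when taking roots of high powers of [x^* x]. *)
Lemma weval_nrm_le (R : realType) (A : cstarAlgType R) (alpha : A -> A)
    (J : set A) (H1 H2 : hilbertType R) (pi1 : A -> 'L(H1)) (U1 : 'L(H1))
    (pi2 : A -> 'L(H2)) (U2 : 'L(H2)) :
  star_morphism alpha ->
  faithful_representation alpha pi1 U1 -> covariant pi1 U1 J ->
  property_star alpha pi1 U1 ->
  representation alpha pi2 U2 -> covariant pi2 U2 J ->
  forall s : seq (monomial A), nrm (weval pi2 U2 s) <= nrm (weval pi1 U1 s).
Proof.
move=> alphaP fr1 cov1 star1 rep2 cov2 s.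
have crep1 := representation_cstar fr1.1.
have crep2 := representation_cstar rep2.
have [M sM] := word_boundedP s.
apply: (@le_of_exp_le _ _ _ M); first exact: nrm_ge0.
move=> k; have tM := word_bounded_power alpha k sM.
rewrite (expnSr 2 k.+1) !exprM -(nrm_weval_power alphaP crep1).
rewrite -(nrm_weval_power alphaP crep2); set t := word_power _ _ _ in tM *.
(* The exponents of [t] are at most [2 ^ k.+1 * M], so there are [2 ^ k.+2 * M + 1] components, the
   factor in [le_of_exp_le]. *)
have [X [-> XX]] := weval_grading alphaP crep2 tM.
rewrite (le_trans (nrm_sum_sqr_le X))// -XX.
rewrite (_ : 2 ^ k.+1 * 2 * M = 2 ^ k.+1 * M + 2 ^ k.+1 * M)%N; last by lia.
rewrite ler_wpM2l//.
(* The degree-0 part is first carried over to the other representation and there bounded by the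
   whole of [t^* t]. *)
rewrite (le_trans (weval_diag_nrm_le alphaP fr1 cov1 rep2 cov2 _))//.
rewrite (le_trans (weval_diag_le alphaP fr1.1 star1 _))//.
by rewrite (weval_mul alphaP crep1) (weval_star crep1) nrm_starM.
Qed.

(** * Extension to the closure *)

(** A relation rather than a map: different words may give the same operator, and single-valuedness
    follows from isometry. The form is also symmetric in the two algebras. *)
Definition isometric_star_relation (R : realType) (B1 B2 : cstarAlgType R)
    (D : B1 -> B2 -> Prop) : Prop :=
  [/\ D 0 0,
      forall (k : R[i]) x y x' y', D x y -> D x' y' ->
        D (k *: x + x') (k *: y + y'),
      forall x y x' y', D x y -> D x' y' -> D (x * x') (y * y'),
      forall x y, D x y -> D (star x) (star y)
    & forall x y, D x y -> nrm x = nrm y].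

Definition relation_closure (R : realType) (B1 B2 : cstarAlgType R)
    (D : B1 -> B2 -> Prop) (x : B1) (y : B2) : Prop :=
  forall e : R, 0 < e ->
    exists x' y', [/\ D x' y', nrm (x - x') < e & nrm (y - y') < e].

Section RelationClosure.
Variables (R : realType) (B1 B2 : cstarAlgType R) (D : B1 -> B2 -> Prop).

(** By this symmetry, injectivity and surjectivity of the extended map come from the lemmas below
    applied to the flipped relation. *)
Lemma relation_closure_flip x y :
  relation_closure (fun y x => D x y) y x <-> relation_closure D x y.
Proof.
by split=> G e /G[u [v [Duv uy vx]]]; exists v, u.
Qed.

Lemma isometric_star_relation_flip :
  isometric_star_relation D -> isometric_star_relation (fun y x => D x y).
Proof.
case=> D0 Dlin DM Ds Diso; split=> //.
- by move=> k x y x' y'; exact: Dlin.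
- by move=> x y x' y'; exact: DM.
- by move=> x y; exact: Ds.
- by move=> x y /Diso.
Qed.

Hypothesis DP : isometric_star_relation D.

Lemma sub_relation_closure x y : D x y -> relation_closure D x y.
Proof. by move=> Dxy e e0; exists x, y; rewrite !subrr !nrm0. Qed.

Lemma relation_closure_isometric x y : relation_closure D x y -> nrm x = nrm y.
Proof.
case: DP => _ _ _ _ Diso G; apply/eqP; rewrite eq_le.
apply/andP; split; apply/ler_addgt0Pr => e e0;
  have e2 : 0 < e / 2 by rewrite divr_gt0.
  have [x' [y' [/Diso xy xx yy]]] := G _ e2.
  by have := nrmD (x - x') x'; have := nrmD (y' - y) y;
    rewrite !subrK (nrmB y'); lra.
have [x' [y' [/Diso xy xx yy]]] := G _ e2.
by have := nrmD (y - y') y'; have := nrmD (x' - x) x;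
  rewrite !subrK (nrmB x'); lra.
Qed.

Lemma relation_closureD k x y x' y' :
  relation_closure D x y -> relation_closure D x' y' ->
  relation_closure D (k *: x + x') (k *: y + y').
Proof.
case: DP => _ Dlin _ _ _ Gxy Gxy' e e0.
set c := complex.Re `|k|.
have c0 : 0 <= c by rewrite -ler0c RRe_real// normr_real.
have d0 : 0 < e / (c + 1) by rewrite divr_gt0// ltr_wpDl.
have [u [v [Duv xu yv]]] := Gxy _ d0.
have [u' [v' [Duv' xu' yv']]] := Gxy' _ d0.
have close (V : cstarAlgType R) (a a' b b' : V) :
    nrm (a - b) < e / (c + 1) -> nrm (a' - b') < e / (c + 1) ->
    nrm (k *: a + a' - (k *: b + b')) < e.
  move=> ab ab'; rewrite opprD addrACA -scalerBr (le_lt_trans (nrmD _ _))//.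
  rewrite nrmZ -/c.
  have -> : e = c * (e / (c + 1)) + e / (c + 1).
    by field; rewrite gt_eqF// ltr_wpDl.
  by rewrite ler_ltD// ler_wpM2l// ltW.
by exists (k *: u + u'), (k *: v + v'); split; [exact: Dlin| |]; apply: close.
Qed.

Lemma relation_closureM x y x' y' :
  relation_closure D x y -> relation_closure D x' y' ->
  relation_closure D (x * x') (y * y').
Proof.
case: DP => _ _ DM _ _ Gxy Gxy' e e0.
pose c := nrm x + nrm x' + nrm y + nrm y' + 1.
have [x0 x'0 y0 y'0] : [/\ 0 <= nrm x, 0 <= nrm x', 0 <= nrm y & 0 <= nrm y'].
  by rewrite !nrm_ge0.
have c0 : 0 < c by rewrite /c; lra.
(* The bound [d <= 1] keeps [nrm b'] below [nrm a' + 1]; the factor 2 makes the final estimate by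
   [d * c] strictly smaller than [e]. *)
pose d := Num.min 1 (e / (2 * c)).
have d0 : 0 < d by rewrite lt_min ltr01 divr_gt0// mulr_gt0.
have d1 : d <= 1 by rewrite ge_min lexx.
have dc : d * (2 * c) <= e.
  by rewrite -ler_pdivlMr ?mulr_gt0// ge_min lexx orbT.
have [u [v [Duv xu yv]]] := Gxy _ d0.
have [u' [v' [Duv' xu' yv']]] := Gxy' _ d0.
have close (V : cstarAlgType R) (a a' b b' : V) :
    nrm a + nrm a' + 1 <= c ->
    nrm (a - b) < d -> nrm (a' - b') < d -> nrm (a * a' - b * b') < e.
  move=> ac ab ab'.
  have -> : a * a' - b * b' = (a - b) * b' + a * (a' - b').
    by rewrite mulrBl mulrBr [RHS]addrC addrA subrK.
  have b'1 : nrm b' <= nrm a' + 1.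
    have := nrmD (b' - a') a'; rewrite subrK nrmB; lra.
  have h1 : nrm ((a - b) * b') <= d * (nrm a' + 1).
    by rewrite (le_trans (nrmM _ _))// ler_pM ?nrm_ge0// ltW.
  have h2 : nrm (a * (a' - b')) <= nrm a * d.
    by rewrite (le_trans (nrmM _ _))// ler_wpM2l ?nrm_ge0// ltW.
  have h3 : d * (nrm a + nrm a' + 1) <= d * c by rewrite ler_wpM2l// ltW.
  have h4 : 0 < d * c by rewrite mulr_gt0.
  have := nrmD ((a - b) * b') (a * (a' - b')); lra.
exists (u * u'), (v * v'); split; [exact: DM| |]; apply: close => //;
  rewrite /c; lra.
Qed.

Lemma relation_closure_star x y :
  relation_closure D x y -> relation_closure D (star x) (star y).
Proof.
case: DP => _ _ _ Ds _ G e /G[x' [y' [Dxy xx yy]]].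
by exists (star x'), (star y'); split; [exact: Ds| |]; rewrite -starB nrm_star.
Qed.

Lemma relation_closureB x y x' y' :
  relation_closure D x y -> relation_closure D x' y' ->
  relation_closure D (x - x') (y - y').
Proof.
move=> Gxy Gxy'; rewrite [x - _]addrC [y - _]addrC.
rewrite -(scaleN1r x') -(scaleN1r y').
exact: relation_closureD.
Qed.

(** The difference of the two pairs is [(0, y - y')], and the closure is isometric. *)
Lemma relation_closure_inj x y y' :
  relation_closure D x y -> relation_closure D x y' -> y = y'.
Proof.
move=> Gxy Gxy'.
have := relation_closure_isometric (relation_closureB Gxy Gxy').
by rewrite subrr nrm0 => /esym/nrm0_eq0/subr0_eq.
Qed.

(** Partners of a convergent sequence in the domain form a Cauchy sequence by isometry, and their
    limit in the complete space [B2] is a partner of the limit. *)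
Lemma relation_closure_dom_closed :
  closed [set x | exists y, relation_closure D x y].
Proof.
apply: nrm_closed => x xG.
have pos (n : nat) : (0 : R) < n.+1%:R^-1 by rewrite invr_gt0.
have /choice[u uP] n : exists z : B1 * B2,
    relation_closure D z.1 z.2 /\ nrm (x - z.1) < n.+1%:R^-1.
  by have [z [y Gzy] xz] := xG _ (pos n); exists (z, y).
have small (e : R) : 0 < e -> exists N : nat, forall n, (N <= n)%N ->
    nrm (x - (u n).1) < e.
  move=> e0; have [N Ne] : exists N : nat, e^-1 < N%:R.
    exists (Num.bound e^-1).
    by apply: archi_boundP; rewrite invr_ge0 ltW.
  exists N => n Nn; rewrite (lt_trans (uP n).2)// invf_plt ?posrE//.
  by rewrite (lt_le_trans Ne)// ler_nat ltnW.
have [e e0|y uy] := @nrm_cauchy_cvg R B2 (fun n => (u n).2).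
  have e2 : 0 < e / 2 by rewrite divr_gt0.
  have [N Ne] := small _ e2; exists N => m n Nm Nn.
  rewrite -(relation_closure_isometric (relation_closureB (uP m).1 (uP n).1)).
  rewrite (le_lt_trans (nrm_triangle x _ _))// (nrmB _ x).
  by have := Ne _ Nm; have := Ne _ Nn; lra.
exists y => e e0; have e2 : 0 < e / 2 by rewrite divr_gt0.
have [N1 xu] := small _ e2; have [N2 yu] := uy _ e2.
have [x' [y' [Dxy xx yy]]] := (uP (maxn N1 N2)).1 _ e2.
exists x', y'; split=> //.
  have := xu _ (leq_maxl N1 N2).
  by have := nrm_triangle (u (maxn N1 N2)).1 x x'; lra.
have := yu _ (leq_maxr N1 N2).
by have := nrm_triangle (u (maxn N1 N2)).2 y y'; lra.
Qed.

(** The domain of the closure is itself a C*-subalgebra containing [X]. *)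
Lemma relation_closure_total (X : set B1) x :
  (forall x, X x -> exists y, D x y) -> cstar_generated X x ->
  exists y, relation_closure D x y.
Proof.
move=> XD /(_ [set x | exists y, relation_closure D x y]); apply.
split=> [|z /XD[y Dzy]]; last first.
  by exists y; exact: sub_relation_closure.
split.
- exact: relation_closure_dom_closed.
- by exists 0; apply: sub_relation_closure; case: DP.
- move=> k z z' [y Gzy] [y' Gzy']; exists (k *: y + y').
  exact: relation_closureD.
- move=> z z' [y Gzy] [y' Gzy']; exists (y * y').
  exact: relation_closureM.
- by move=> z [y Gzy]; exists (star y); exact: relation_closure_star.
Qed.

Lemma relation_closure_dom (X : set B1) x y :
  (forall x y, D x y -> cstar_generated X x) ->
  relation_closure D x y -> cstar_generated X x.
Proof.
move=> DX Gxy M [MC XM]; case: (MC) => Mcl _ _ _ _.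
apply: (closed_nrmP Mcl) => e /Gxy[x' [y' [Dxy xx _]]].
by exists x' => //; apply: DX Dxy _ _.
Qed.

End RelationClosure.

Lemma isometric_star_relation_extends (R : realType) (B1 B2 : cstarAlgType R)
    (D : B1 -> B2 -> Prop) (X1 : set B1) (X2 : set B2) :
  isometric_star_relation D ->
  (forall x, X1 x -> exists y, D x y) -> (forall y, X2 y -> exists x, D x y) ->
  (forall x y, D x y -> cstar_generated X1 x) ->
  (forall x y, D x y -> cstar_generated X2 y) ->
  exists2 Phi : B1 -> B2,
    star_isomorphism (cstar_generated X1) (cstar_generated X2) Phi
    & forall x y, D x y -> Phi x = y.
Proof.
move=> DP X1D X2D DX1 DX2.
have DfP := isometric_star_relation_flip DP.
(* The default value 0 is taken only outside the generated subalgebra, where [star_isomorphism]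
   imposes nothing. *)
pose Phi x := xget 0 [set y | relation_closure D x y].
have PhiE x y : relation_closure D x y -> Phi x = y.
  move=> Gxy; apply: (relation_closure_inj DP _ Gxy).
  exact: (xgetPex 0 (ex_intro _ y Gxy)).
have PhiP x : cstar_generated X1 x -> relation_closure D x (Phi x).
  by move=> /(relation_closure_total DP X1D)[y Gxy]; rewrite (PhiE _ _ Gxy).
exists Phi; last by move=> x y /sub_relation_closure/PhiE.
split.
- split.
  + move=> x /PhiP /relation_closure_flip.
    by apply: relation_closure_dom => y z; exact: DX2.
  + move=> x x' /set_mem/PhiP Gx /set_mem/PhiP Gx' xx'; rewrite xx' in Gx.
    move/relation_closure_flip: Gx => Gx.
    move/relation_closure_flip: Gx' => Gx'.
    exact: (relation_closure_inj DfP Gx Gx').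
  + move=> y /(relation_closure_total DfP X2D)[x /relation_closure_flip Gxy].
    by exists x; [exact: relation_closure_dom Gxy|exact: PhiE].
- by move=> k x x' /PhiP Gx /PhiP Gx'; apply/PhiE/relation_closureD.
- by move=> x x' /PhiP Gx /PhiP Gx'; apply/PhiE/relation_closureM.
- by move=> x /PhiP Gx; apply/PhiE/relation_closure_star.
Qed.

(** * The isomorphism of the generated C*-algebras *)

Lemma weval_cstar_generated (R : realType) (A B : cstarAlgType R)
    (alpha : A -> A) (pi : A -> B) (U : B) :
  cstar_representation alpha pi U ->
  forall s, cstar_generated (range pi `|` [set U]) (weval pi U s).
Proof.
move=> rep s M [[_ M0 Mlin MM Ms] XM].
have Mpi a : M (pi a) by apply: XM; left; exists a.
have MU : M U by apply: XM; right.
have M1 : M 1 by rewrite -(crep_unital rep).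
have MX x n : M x -> M (x ^+ n).
  by move=> Mx; elim: n => [|n IH]; rewrite ?expr0// exprS; apply: MM.
have MD x y : M x -> M y -> M (x + y).
  by move=> Mx My; rewrite -[x]scale1r; apply: Mlin.
rewrite /weval; elim/big_ind: _ => // x _.
by apply: (MM); [apply: (MM)|] => //; apply: MX => //; apply: Ms.
Qed.

Theorem theorem3p1 (R : realType) (A : cstarAlgType R) (alpha : A -> A)
    (J : set A) (H1 H2 : hilbertType R)
    (pi1 : A -> 'L(H1)) (U1 : 'L(H1)) (pi2 : A -> 'L(H2)) (U2 : 'L(H2))
    (alpha_endo : star_morphism alpha)
    (J_ideal : closed_ideal J)
    (J_ker : J `&` [set a | alpha a = 0] = [set 0])
    (faithful1 : faithful_representation alpha pi1 U1)
    (covariant1 : covariant pi1 U1 J)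
    (star1 : property_star alpha pi1 U1)
    (faithful2 : faithful_representation alpha pi2 U2)
    (covariant2 : covariant pi2 U2 J)
    (star2 : property_star alpha pi2 U2) :
  exists Phi : 'L(H1) -> 'L(H2),
    [/\ star_isomorphism (cstar_of_representation pi1 U1)
                         (cstar_of_representation pi2 U2) Phi,
        forall a : A, Phi (pi1 a) = pi2 a
      & Phi U1 = U2].
Proof.
have rep1 := representation_cstar faithful1.1.
have rep2 := representation_cstar faithful2.1.
(* Operators given by the same word are related; the norm comparison, used in both directions, makes
   this relation isometric. *)
pose D (x : 'L(H1)) (y : 'L(H2)) :=
  exists s : seq (monomial A), x = weval pi1 U1 s /\ y = weval pi2 U2 s.
have DP : @isometric_star_relation R 'L(H1) 'L(H2) D.
  split.
  - by exists [::]; rewrite /weval !big_nil.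
  - move=> k _ _ _ _ [s [-> ->]] [t [-> ->]].
    exists ([seq (x.1.1, k *: x.1.2, x.2) | x <- s] ++ t).
    by rewrite !weval_cat (weval_scale rep1) (weval_scale rep2).
  - move=> _ _ _ _ [s [-> ->]] [t [-> ->]]; exists (word_mul alpha s t).
    by rewrite (weval_mul alpha_endo rep1) (weval_mul alpha_endo rep2).
  - move=> _ _ [s [-> ->]]; exists (word_star s).
    by rewrite (weval_star rep1) (weval_star rep2).
  - move=> _ _ [s [-> ->]]; apply/eqP; rewrite eq_le; apply/andP; split.
      exact: (weval_nrm_le alpha_endo faithful2 covariant2 star2 faithful1.1).
    exact: (weval_nrm_le alpha_endo faithful1 covariant1 star1 faithful2.1).
have evpi (H : hilbertType R) (pi : A -> 'L(H)) (U : 'L(H)) a :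
    pi a = weval pi U [:: (0%N, a, 0%N)].
  by rewrite /weval big_seq1 /meval /= !expr0 mul1r mulr1.
have Dpi a : D (pi1 a) (pi2 a) by exists [:: (0%N, a, 0%N)]; rewrite -!evpi.
have evU (H : hilbertType R) (pi : A -> 'L(H)) (U : 'L(H)) :
    @cstar_representation R A 'L(H) alpha pi U ->
    U = weval pi U [:: (0%N, 1, 1%N)].
  by move=> rep; rewrite /weval big_seq1 /meval /= (crep_unital rep) !mul1r.
have DU : D U1 U2.
  by exists [:: (0%N, 1, 1%N)]; rewrite -(evU _ _ _ rep1) -(evU _ _ _ rep2).
have [||||Phi PhiI PhiE] := @isometric_star_relation_extends R 'L(H1) 'L(H2) D
    (range pi1 `|` [set U1]) (range pi2 `|` [set U2]) DP.
- by move=> _ [[a _ <-]|->]; [exists (pi2 a)|exists U2].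
- by move=> _ [[a _ <-]|->]; [exists (pi1 a)|exists U1].
- by move=> _ _ [s [-> _]]; apply: weval_cstar_generated rep1 s.
- by move=> _ _ [s [_ ->]]; apply: weval_cstar_generated rep2 s.
by exists Phi; split=> [//|a|]; apply: PhiE.
Qed.
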